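(* Assume: $f=F\circ G$ is convex and $h$ is $\mu$-strongly convex with $\mu>0$; every $F_i$ is $L_F$-smooth with $B_F$-bounded gradient and every $G_j$ is $L_G$-smooth with $B_G$-bounded Jacobian; $\|[\nabla G_j(x)]^\top\nabla F_i(G(x))-[\nabla G_j(y)]^\top\nabla F_i(G(y))\|\le L\|x-y\|$ for all $i\in[n_1]$, $j\in[n_2]$ and $x,y\in\mathbb R^{N_2}$; and $L\ge\mu$. Let $x^*$ be the minimizer of $H=f+h$. Let $\{\widetilde x^s\}$ be generated by the algorithm SoCK with Option II, started at $x_0$, with parameters $$m=\left\lceil \tfrac12\sqrt{L/\mu}\right\rceil,\quad \tau_1=\tau_2=\frac1{2m},\quad \theta=1+\frac1{12m},\quad \alpha=\frac1{3\tau_1L},$$ $$A=\frac{2160B_G^4L_F^2}{\mu^2},\quad B=\frac{2160B_F^2L_G^2}{\mu^2},\quad C=\frac{1080L^2}{\mu^2},$$ where the values of $A,B,C$ are rounded up to the nearest positive integer. Then, for every number $S\ge1$ of outer loops, $$\mathbb E\big[H(\widetilde x^{S})-H(x^* )\big]\le 11\left(\frac{12}{13}\right)^{S}\big(H(x_0)-H(x^* )\big).$$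
   Context: Problem: $\min_{x\in\mathbb R^{N_2}}H(x)=f(x)+h(x)$ with $f=F\circ G$, $F=\frac1{n_1}\sum_{i=1}^{n_1}F_i$, $G=\frac1{n_2}\sum_{j=1}^{n_2}G_j$, where $F_i:\mathbb R^{N_1}\to\mathbb R$ and $G_j:\mathbb R^{N_2}\to\mathbb R^{N_1}$ are differentiable and $h:\mathbb R^{N_2}\to\mathbb R\cup\{+\infty\}$ is a proper closed convex function. $\nabla$ denotes the gradient of a scalar function and the Jacobian matrix of a vector-valued map; $\|\cdot\|$ is the Euclidean norm of vectors and the spectral norm of matrices; $[n]=\{1,\dots,n\}$. A differentiable map $\phi$ is $l$-smooth if $\|\nabla\phi(x)-\nabla\phi(x')\|\le l\|x-x'\|$ for all $x,x'$; it has $b$-bounded gradient/Jacobian if $\|\nabla\phi(x)\|\le b$ for all $x$. $h$ is $\mu$-strongly convex if $h(x')\ge h(x)+\langle g,x'-x\rangle+\frac\mu2\|x'-x\|^2$ for every $x,x'$ and every subgradient $g$ of $h$ at $x$. Algorithm SoCK (Option II). Inputs: $x_0\in\mathbb R^{N_2}$ with $h(x_0)<\infty$, positive integers $S,m,A,B,C$, reals $\theta>1$, $\alpha>0$, $\tau_1,\tau_2$. Set $y_0=z_0=\widetilde x^0=x_0$. For $s=0,\dots,S-1$: for $j=0,\dots,m-1$, put $k=sm+j$ and (1) $x_{k+1}=\tau_1z_k+\tau_2\widetilde x^s+(1-\tau_1-\tau_2)y_k$; (2) draw multisets $\mathcal A_k,\mathcal B_k$ from $[n_2]$ and $\mathcal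 C_k$ from $[n_1]$, uniformly at random with replacement, with $|\mathcal A_k|=A$, $|\mathcal B_k|=B$, $|\mathcal C_k|=C$ (all draws mutually independent); (3) $\widehat G_k=\frac1A\sum_{i\in\mathcal A_k}(G_i(x_{k+1})-G_i(\widetilde x^s))+G(\widetilde x^s)$ and $\nabla\widehat G_k=\frac1B\sum_{i\in\mathcal B_k}(\nabla G_i(x_{k+1})-\nabla G_i(\widetilde x^s))+\nabla G(\widetilde x^s)$; (4) $\widetilde\nabla_{k+1}=\frac1C\sum_{i\in\mathcal C_k}\big([\nabla\widehat G_k]^\top\nabla F_i(\widehat G_k)-[\nabla G(\widetilde x^s)]^\top\nabla F_i(G(\widetilde x^s))\big)+\nabla f(\widetilde x^s)$; (5) $z_{k+1}=\arg\min_z\{\langle\widetilde\nabla_{k+1},z\rangle+\frac1{2\alpha}\|z-z_k\|^2+h(z)\}$; (6) $y_{k+1}=\arg\min_y\{\langle\widetilde\nabla_{k+1},y\rangle+\frac{3L}2\|y-x_{k+1}\|^2+h(y)\}$. After the inner loop, $\widetilde x^{s+1}=\big(\sum_{j=0}^{m-1}\theta^j\big)^{-1}\sum_{j=0}^{m-1}\theta^jy_{sm+j+1}$. The output is $\widetilde x^S$. $\mathbb E$ is expectation over all random draws. *)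

(* Defs.v *)
From mathcomp Require Export all_boot all_order all_algebra.
From mathcomp Require Export all_classical all_reals all_analysis.

Set Implicit Arguments.
Unset Strict Implicit.
Unset Printing Implicit Defensive.

Export Order.TTheory GRing.Theory Num.Theory.
Export numFieldNormedType.Exports.

Local Open Scope classical_set_scope.
Local Open Scope ring_scope.

(* Vectors of R^N are row vectors.  The norm `|x| that the library puts on
   'rV[R]_N is the sup norm; it only serves to provide the (same) topology and
   the differential, and all quantitative statements use [enorm]. *)

Section Euclidean.
Context {R : realType}.

Definition dot {N} (u v : 'rV[R]_N) : R := \sum_(i < N) u 0 i * v 0 i.

Definition enorm {N} (u : 'rV[R]_N) : R := Num.sqrt (dot u u).

(* u *m M^T is the row-vector form of the column vector M u^T. *)
Definition spectral_norm {p q} (M : 'M[R]_(p, q)) : R :=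
  sup [set enorm (u *m M^T) | u in [set u : 'rV[R]_q | enorm u <= 1]].

Definition grad {N} (phi : 'rV[R]_N -> R) (x : 'rV[R]_N) : 'rV[R]_N :=
  \row_i 'd (phi : 'rV[R]_N -> R^o) x (delta_mx 0 i).

(* The library's 'J acts on row vectors from the right, so it is the transpose
   of the Jacobian matrix with entries d(phi_i)/d(x_j).  With these conventions
   the vector [jac G x]^T (grad F u) reads grad F u *m jac G x. *)
Definition jac {N M} (phi : 'rV[R]_N -> 'rV[R]_M) (x : 'rV[R]_N) : 'M[R]_(M, N) :=
  ('J phi x)^T.

Definition smooth_fun {N} (l : R) (phi : 'rV[R]_N -> R) : Prop :=
  (forall x, differentiable (phi : 'rV[R]_N -> R^o) x) /\
  forall x x', enorm (grad phi x - grad phi x') <= l * enorm (x - x').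

Definition smooth_map {N M} (l : R) (phi : 'rV[R]_N -> 'rV[R]_M) : Prop :=
  (forall x, differentiable phi x) /\
  forall x x', spectral_norm (jac phi x - jac phi x') <= l * enorm (x - x').

Definition bounded_grad {N} (b : R) (phi : 'rV[R]_N -> R) : Prop :=
  forall x, enorm (grad phi x) <= b.

Definition bounded_jac {N M} (b : R) (phi : 'rV[R]_N -> 'rV[R]_M) : Prop :=
  forall x, spectral_norm (jac phi x) <= b.

End Euclidean.

Section ConvexAnalysis.
Context {R : realType} {N : nat}.
Implicit Types (h phi : 'rV[R]_N -> \bar R) (x g : 'rV[R]_N).

Definition epigraph h : set ('rV[R]_N * R^o)%type :=
  [set p | (h p.1 <= p.2%:E)%E].

Definition proper_closed_convex h : Prop :=
  [/\ (forall x, -oo < h x)%E, (exists x, h x < +oo)%E,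
      closed (epigraph h) & convex_set (epigraph h)].

(* For proper h no g satisfies this at a point where h is +oo. *)
Definition subgradient h x g : Prop :=
  forall x', (h x + (dot g (x' - x))%:E <= h x')%E.

Definition strongly_convex (mu : R) h : Prop :=
  forall x x' g, subgradient h x g ->
    (h x + (dot g (x' - x) + mu / 2 * enorm (x' - x) ^+ 2)%:E <= h x')%E.

Definition minimizer phi x : Prop := forall x', (phi x <= phi x')%E.

(* In the algorithm phi is a proper closed strongly convex function, which has
   exactly one minimizer; the default value 0 plays no role there. *)
Definition argmin phi : 'rV[R]_N := xget 0 [set x | minimizer phi x].

End ConvexAnalysis.

Section SoCK.
Context {R : realType} {N1 N2 n1 n2 : nat}.
Variables (F : 'I_n1 -> 'rV[R]_N1 -> R) (G : 'I_n2 -> 'rV[R]_N2 -> 'rV[R]_N1).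
Variable h : 'rV[R]_N2 -> \bar R.

Definition meanF (u : 'rV[R]_N1) : R := n1%:R^-1 * \sum_(i < n1) F i u.

Definition meanG (x : 'rV[R]_N2) : 'rV[R]_N1 := n2%:R^-1 *: \sum_(j < n2) G j x.

Definition objf (x : 'rV[R]_N2) : R := meanF (meanG x).

Definition objH (x : 'rV[R]_N2) : \bar R := ((objf x)%:E + h x)%E.

Variables (L theta alpha tau1 tau2 : R) (m A B C : nat).

(* The samples (A_k, B_k, C_k) drawn with replacement in one inner iteration. *)
Definition draw : finType :=
  (A.-tuple 'I_n2 * B.-tuple 'I_n2 * C.-tuple 'I_n1)%type.

Definition est_G (d : draw) (xt x : 'rV[R]_N2) : 'rV[R]_N1 :=
  A%:R^-1 *: \sum_(i <- d.1.1) (G i x - G i xt) + meanG xt.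

Definition est_jacG (d : draw) (xt x : 'rV[R]_N2) : 'M[R]_(N1, N2) :=
  B%:R^-1 *: \sum_(i <- d.1.2) (jac (G i) x - jac (G i) xt) + jac meanG xt.

Definition est_grad (d : draw) (xt x : 'rV[R]_N2) : 'rV[R]_N2 :=
  C%:R^-1 *: \sum_(i <- d.2)
      (grad (F i) (est_G d xt x) *m est_jacG d xt x
       - grad (F i) (meanG xt) *m jac meanG xt)
  + grad objf xt.

(* From (y_k, z_k) to (y_{k+1}, z_{k+1}), xt being the current snapshot. *)
Definition inner_step (xt : 'rV[R]_N2) (yz : 'rV[R]_N2 * 'rV[R]_N2) (d : draw) :
    'rV[R]_N2 * 'rV[R]_N2 :=
  let: (y, z) := yz in
  let x := tau1 *: z + tau2 *: xt + (1 - tau1 - tau2) *: y in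
  let g := est_grad d xt x in
  let z' := argmin (fun w =>
    ((dot g w + (2 * alpha)^-1 * enorm (w - z) ^+ 2)%:E + h w)%E) in
  let y' := argmin (fun w =>
    ((dot g w + 3 * L / 2 * enorm (w - x) ^+ 2)%:E + h w)%E) in
  (y', z').

(* One outer iteration on (xt^s, y_{sm}, z_{sm}); the j-th entry of [its] is
   (y_{sm+j+1}, z_{sm+j+1}). *)
Definition outer_step (st : 'rV[R]_N2 * 'rV[R]_N2 * 'rV[R]_N2)
    (ds : m.-tuple draw) : 'rV[R]_N2 * 'rV[R]_N2 * 'rV[R]_N2 :=
  let: (xt, y, z) := st in
  let its := scanl (inner_step xt) (y, z) ds in
  let xt' := (\sum_(j < m) theta ^+ j)^-1 *:
             \sum_(j < m) theta ^+ j *: (nth (y, z) its j).1 in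
  let: (y', z') := last (y, z) its in
  (xt', y', z').

(* The output xt^S, where w gives the samples of iteration k = s m + j in
   position j of its s-th component. *)
Definition SoCK (x0 : 'rV[R]_N2) (S : nat) (w : S.-tuple (m.-tuple draw)) :
    'rV[R]_N2 :=
  (foldl outer_step (x0, x0, x0) w).1.1.

End SoCK.

(* Expectation under the uniform distribution.  On S.-tuple (m.-tuple draw)
   this is the joint law of independent samples drawn uniformly with
   replacement. *)
Definition expectation_unif {R : realType} {T : finType} (X : T -> \bar R) :
    \bar R :=
  ((#|T|%:R^-1)%:E * \sum_(w : T) X w)%E.

Definition pos_ceil {R : realType} (x : R) : nat := maxn 1 `|Num.ceil x|%N.

(* Main.v *)
(* The proof is a Lyapunov argument that never uses unbiasedness of the gradient
   estimate.  With e the error of the estimate at x, the two proximal steps give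
   pathwise, for H = f + h, u = x^* and Z = |u - z|^2,
     H(y') - H(u) + tau (1/(2 alpha) + mu/2) Z' <= tau (H(xt) - H(u))
       + (1 - 2 tau) (H(y) - H(u)) + tau <e, u - z> + tau/(2 alpha) Z + |e|^2/(4L).
   Young's inequality bounds <e, u - z> by mu/5 Z plus a multiple of |e|^2/mu, and
   the batch sizes are such that E|e|^2 <= (mu^2/180) |x - xt|^2.  Strong convexity
   turns |x - xt|^2 back into Z and the gaps at xt and y, and enough of the gain
   mu/2 in the coefficient of Z' is left to pay for the factor theta.  Summing the
   inequalities with weights theta^j, the combination
     cT Theta (H(xt) - H(u)) + kappa (H(y) - H(u)) + K Z,  Theta = sum_j theta^j,
   contracts in expectation by theta^{-m} <= 12/13 over one outer loop. *)

(* The estimate is biased: [grad (F i)] is evaluated at the random point [est_G], so <e, u - z> need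
   not average to zero and is absorbed pathwise. The strong convexity of h pays for this; the error
   must therefore be of order mu |x - xt|, which forces batch sizes of order mu^-2. All bounds for
   one step hold from arbitrary fixed xt, y, z (with xt and y in the domain of h). Conditioning on
   the past thus reduces to averaging over one draw at a time, and the expectation over a whole run
   is an iterated finite average. Two obstacles come from h being extended-valued. [argmin] is a
   choice with a default, so proximal points must first be shown to exist; and H is a real number
   only on the domain of h, so membership of y and of the snapshots in it is carried through both
   loops. *)
From HB Require Import structures.
Require Import Defs.
From mathcomp Require Import ring lra.

Set Implicit Arguments.
Unset Strict Implicit.
Unset Printing Implicit Defensive.

Local Open Scope classical_set_scope.
Local Open Scope ring_scope.

(** * Euclidean space *)

Section EuclideanSpace.
Context {R : realType}.
Implicit Types N M : nat.

Lemma dotC N (u v : 'rV[R]_N) : dot u v = dot v u.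
Proof. by apply: eq_bigr => i _; rewrite mulrC. Qed.

Lemma dotDl N (u v w : 'rV[R]_N) : dot (u + v) w = dot u w + dot v w.
Proof. by rewrite -big_split; apply: eq_bigr => i _; rewrite mxE mulrDl. Qed.

Lemma dotDr N (u v w : 'rV[R]_N) : dot w (u + v) = dot w u + dot w v.
Proof. by rewrite dotC dotDl !(dotC w). Qed.

Lemma dotZl N a (u v : 'rV[R]_N) : dot (a *: u) v = a * dot u v.
Proof. by rewrite mulr_sumr; apply: eq_bigr => i _; rewrite mxE mulrA. Qed.

Lemma dotZr N a (u v : 'rV[R]_N) : dot u (a *: v) = a * dot u v.
Proof. by rewrite dotC dotZl dotC. Qed.

Lemma dotNl N (u v : 'rV[R]_N) : dot (- u) v = - dot u v.
Proof. by rewrite -scaleN1r dotZl mulN1r. Qed.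

Lemma dotNr N (u v : 'rV[R]_N) : dot u (- v) = - dot u v.
Proof. by rewrite dotC dotNl dotC. Qed.

Lemma dot0l N (v : 'rV[R]_N) : dot 0 v = 0.
Proof. by rewrite -(scale0r 0) dotZl mul0r. Qed.

Lemma dot_sumr N (I : Type) (r : seq I) (P : pred I) (u : I -> 'rV[R]_N) v :
  dot v (\sum_(i <- r | P i) u i) = \sum_(i <- r | P i) dot v (u i).
Proof.
apply: (big_morph (dot v) (fun a b => dotDr a b v)).
by rewrite dotC dot0l.
Qed.

Definition dotE := (dotDl, dotDr, dotNl, dotNr, dotZl, dotZr).

Lemma dot_mulmx N M (u : 'rV[R]_N) (v : 'rV[R]_M) (A : 'M[R]_(N, M)) :
  dot (u *m A) v = dot u (v *m A^T).
Proof.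
rewrite /dot.
under eq_bigr do rewrite mxE mulr_suml.
rewrite exchange_big; apply: eq_bigr => i _; rewrite mxE mulr_sumr.
by apply: eq_bigr => j _; rewrite !mxE; ring.
Qed.

Lemma dot_ge0 N (u : 'rV[R]_N) : 0 <= dot u u.
Proof. by apply: sumr_ge0 => i _; rewrite -expr2 sqr_ge0. Qed.

Lemma dot_eq0 N (u : 'rV[R]_N) : dot u u = 0 -> u = 0.
Proof.
move/eqP; rewrite psumr_eq0 => [/allP u0|i _]; last by rewrite -expr2 sqr_ge0.
apply/rowP => i; rewrite mxE; have := u0 i (mem_index_enum _).
by rewrite -expr2 sqrf_eq0 => /eqP.
Qed.

Lemma enorm_ge0 N (u : 'rV[R]_N) : 0 <= enorm u.
Proof. exact: sqrtr_ge0. Qed.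

Lemma enorm_sqr N (u : 'rV[R]_N) : enorm u ^+ 2 = dot u u.
Proof. by rewrite sqr_sqrtr// dot_ge0. Qed.

Lemma enorm0 N : enorm (0 : 'rV[R]_N) = 0.
Proof. by rewrite /enorm dot0l sqrtr0. Qed.

Lemma enormZ N a (u : 'rV[R]_N) : enorm (a *: u) = `|a| * enorm u.
Proof.
by rewrite /enorm dotZl dotZr mulrA -expr2 sqrtrM ?sqr_ge0// sqrtr_sqr.
Qed.

Lemma enormN N (u : 'rV[R]_N) : enorm (- u) = enorm u.
Proof. by rewrite /enorm dotNl dotNr opprK. Qed.

Lemma cauchy_schwarz N (u v : 'rV[R]_N) : dot u v <= enorm u * enorm v.
Proof.
have [v0|v_neq0] := eqVneq (dot v v) 0.
  by rewrite (dot_eq0 v0) enorm0 mulr0 dotC dot0l.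
have vv_gt0 : 0 < dot v v by rewrite lt_def v_neq0 dot_ge0.
apply: (le_trans (ler_norm _)).
rewrite -ler_sqr ?nnegrE ?mulr_ge0 ?enorm_ge0// real_normK ?num_real//.
rewrite exprMn !enorm_sqr.
have := dot_ge0 (u - (dot u v / dot v v) *: v).
rewrite !dotE (dotC v u).
set s := dot u v; set w := dot v v in vv_gt0 v_neq0 *.
rewrite [leRHS](_ : _ = dot u u - s ^+ 2 / w); last by field.
by rewrite subr_ge0 ler_pdivrMr.
Qed.

Lemma ler_enormD N (u v : 'rV[R]_N) : enorm (u + v) <= enorm u + enorm v.
Proof.
rewrite -ler_sqr ?nnegrE ?addr_ge0 ?enorm_ge0// enorm_sqr !dotE (dotC v u).
have := cauchy_schwarz u v.
by rewrite sqrrD !enorm_sqr; lra.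
Qed.

Lemma ler_enorm_sum N (I : Type) (r : seq I) (u : I -> 'rV[R]_N) :
  enorm (\sum_(i <- r) u i) <= \sum_(i <- r) enorm (u i).
Proof.
elim: r => [|i r IH]; first by rewrite !big_nil enorm0.
by rewrite !big_cons (le_trans (ler_enormD _ _))// lerD2l.
Qed.

Lemma ler_enorm_mean N (I : Type) (r : seq I) (n : nat) (u : I -> 'rV[R]_N) c :
  (0 < n)%N -> size r = n -> (forall i, enorm (u i) <= c) ->
  enorm (n%:R^-1 *: \sum_(i <- r) u i) <= c.
Proof.
move=> n_gt0 rn uc; have n_gt0' : 0 < n%:R :> R by rewrite ltr0n.
rewrite enormZ ger0_norm ?invr_ge0 ?ler0n// mulrC ler_pdivrMr//.
apply: (le_trans (ler_enorm_sum _ _)).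
apply: (@le_trans _ _ (\sum_(i <- r) c)); first exact: ler_sum.
by rewrite big_const_seq count_predT rn iter_addr_0 mulr_natr.
Qed.

Lemma dot_le_sqr N (u : 'rV[R]_N) a : enorm u <= a -> dot u u <= a ^+ 2.
Proof.
move=> ua; rewrite -enorm_sqr ler_sqr ?nnegrE ?enorm_ge0//.
exact: le_trans (enorm_ge0 _) ua.
Qed.

Lemma young_dot N (u v : 'rV[R]_N) s :
  0 < s -> dot u v <= s / 2 * dot u u + (2 * s)^-1 * dot v v.
Proof.
move=> s_gt0; rewrite -subr_ge0.
have := dot_ge0 (s *: u - v).
rewrite !dotE (dotC v u) => H.
rewrite (_ : _ - _ = (2 * s)^-1 *
  (s * (s * dot u u - dot u v) - (s * dot u v - dot v v))); last first.
  by field; rewrite gt_eqF.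
apply: mulr_ge0; first by rewrite invr_ge0 mulr_ge0// ltW.
by lra.
Qed.

Lemma dot_sqrD_le N (u v : 'rV[R]_N) :
  dot (u + v) (u + v) <= 2 * dot u u + 2 * dot v v.
Proof. by have := dot_ge0 (u - v); rewrite !dotE (dotC v u); lra. Qed.

Lemma dot_sqrD3_le N (u v w : 'rV[R]_N) :
  dot (u + v + w) (u + v + w) <= 3 * (dot u u + dot v v + dot w w).
Proof.
have := dot_ge0 (u - v); have := dot_ge0 (u - w); have := dot_ge0 (v - w).
by rewrite !dotE (dotC v u) (dotC w u) (dotC w v); lra.
Qed.

(** Convexity of the squared norm, with the missing weight 1 - a - b placed at the origin. *)
Lemma dot_sqr_conv2_le N (u v : 'rV[R]_N) a b : 0 <= a -> 0 <= b -> a + b <= 1 ->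
  dot (a *: u + b *: v) (a *: u + b *: v) <= a * dot u u + b * dot v v.
Proof.
move=> a0 b0 ab1; rewrite -subr_ge0 !dotE (dotC v u).
rewrite (_ : _ - _ = a * b * (dot u u - 2 * dot u v + dot v v)
  + (1 - a - b) * (a * dot u u + b * dot v v)); last by ring.
apply: addr_ge0; apply: mulr_ge0.
- exact: mulr_ge0.
- by have := dot_ge0 (u - v); rewrite !dotE (dotC v u); lra.
- by lra.
- by rewrite addr_ge0// mulr_ge0// dot_ge0.
Qed.

(** A [sup] is informative only on a bounded set; the bound here is the Frobenius norm, by
    Cauchy-Schwarz on each row. *)
Lemma spectral_set_ubound p q (A : 'M[R]_(p, q)) :
  has_ubound [set enorm (u *m A^T) | u in [set u : 'rV[R]_q | enorm u <= 1]].
Proof.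
exists (Num.sqrt (\sum_(i < p) dot (row i A) (row i A))) => _ [u /= u1 <-].
rewrite ler_wsqrtr// /dot; apply: ler_sum => i _.
have -> : (u *m A^T) 0 i = dot u (row i A).
  by rewrite mxE; apply: eq_bigr => j _; rewrite !mxE.
rewrite -expr2 -real_normK ?num_real// -[leRHS]enorm_sqr ler_sqr ?nnegrE ?enorm_ge0//.
suff H : forall w : 'rV_q, dot u w <= enorm w.
  by rewrite ler_norml H andbT lerNl -dotNr -[leRHS]enormN H.
move=> w; apply: (le_trans (cauchy_schwarz _ _)).
by rewrite ler_piMl ?enorm_ge0.
Qed.

Lemma spectral_norm_ge0 p q (A : 'M[R]_(p, q)) : 0 <= spectral_norm A.
Proof.
apply: ub_le_sup; first exact: spectral_set_ubound.
by exists 0; rewrite /= ?mul0mx enorm0 ?ler01.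
Qed.

Lemma enorm_mulmx_tr p q (A : 'M[R]_(p, q)) (u : 'rV[R]_q) :
  enorm (u *m A^T) <= spectral_norm A * enorm u.
Proof.
have [u0|u_neq0] := eqVneq (enorm u) 0.
  have /dot_eq0-> : dot u u = 0 by rewrite -enorm_sqr u0 expr0n.
  by rewrite mul0mx !enorm0 mulr0.
have u_gt0 : 0 < enorm u by rewrite lt_def u_neq0 enorm_ge0.
rewrite -ler_pdivrMr//.
have -> : enorm (u *m A^T) / enorm u = enorm (((enorm u)^-1 *: u) *m A^T).
  by rewrite -scalemxAl enormZ ger0_norm ?invr_ge0 ?enorm_ge0// mulrC.
apply: ub_le_sup; first exact: spectral_set_ubound.
exists ((enorm u)^-1 *: u) => //=.
by rewrite enormZ ger0_norm ?invr_ge0 ?enorm_ge0// mulVf.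
Qed.

(** [spectral_norm] measures right multiplication by A^T. Duality gives the same constant for A:
    |vA|^2 = <v, (vA) A^T>, and one factor |vA| cancels. *)
Lemma enorm_mulmx p q (A : 'M[R]_(p, q)) (v : 'rV[R]_p) :
  enorm (v *m A) <= spectral_norm A * enorm v.
Proof.
have [w0|w_neq0] := eqVneq (enorm (v *m A)) 0.
  by rewrite w0 mulr_ge0 ?spectral_norm_ge0 ?enorm_ge0.
have w_gt0 : 0 < enorm (v *m A) by rewrite lt_def w_neq0 enorm_ge0.
rewrite -(ler_pM2r w_gt0) -expr2 enorm_sqr dot_mulmx.
apply: (le_trans (cauchy_schwarz _ _)).
rewrite [leRHS](_ : _ = enorm v * (spectral_norm A * enorm (v *m A))); last by ring.
by rewrite ler_wpM2l ?enorm_ge0 ?enorm_mulmx_tr.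
Qed.

End EuclideanSpace.

(** * Gradients and Jacobians *)

Section Gradients.
Context {R : realType}.
Implicit Types N M : nat.

Lemma continuous_dot (T : topologicalType) N (f g : T -> 'rV[R]_N) :
  continuous f -> continuous g -> continuous (fun t => dot (f t) (g t)).
Proof.
move=> cf cg t; apply: cvg_big => [|i _]; first exact: add_continuous.
by apply: cvgM; [exact: (cvg_comp _ _ (cf t) (@coord_continuous _ _ _ _ _ _))|
  exact: (cvg_comp _ _ (cg t) (@coord_continuous _ _ _ _ _ _))].
Qed.

Lemma diff_grad N (phi : 'rV[R]_N -> R) (x v : 'rV[R]_N) :
  'd (phi : 'rV[R]_N -> R^o) x v = dot (grad phi x) v.
Proof.
rewrite {1}(row_sum_delta v) linear_sum.
by apply: eq_bigr => i _; rewrite linearZ mxE mulrC.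
Qed.

Lemma diff_jac N M (phi : 'rV[R]_N -> 'rV[R]_M) (x v : 'rV[R]_N) :
  'd phi x v = v *m (jac phi x)^T.
Proof. by rewrite /jac trmxK /jacobian mul_rV_lin1. Qed.

Lemma grad_unique N (phi : 'rV[R]_N -> R) (x g : 'rV[R]_N) :
  (forall v, 'd (phi : 'rV[R]_N -> R^o) x v = dot g v) -> grad phi x = g.
Proof.
move=> dphi; apply/rowP => i; rewrite mxE dphi dotC /dot (bigD1 i)//= big1.
  by rewrite mxE !eqxx mul1r addr0.
by move=> j ji; rewrite mxE (negbTE ji) mul0r.
Qed.

Lemma jac_unique N M (phi : 'rV[R]_N -> 'rV[R]_M) (x : 'rV[R]_N) A :
  (forall v, 'd phi x v = v *m A^T) -> jac phi x = A.
Proof.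
move=> dphi; apply: trmx_inj; apply/row_matrixP => i.
by rewrite !rowE -diff_jac dphi.
Qed.

Lemma grad_comp N M (phi : 'rV[R]_M -> R) (G : 'rV[R]_N -> 'rV[R]_M) x :
  differentiable G x -> differentiable (phi : _ -> R^o) (G x) ->
  grad (phi \o G) x = grad phi (G x) *m jac G x.
Proof.
move=> dG dphi; apply: grad_unique => v.
rewrite (_ : (phi \o G : _ -> R^o) = (phi : _ -> R^o) \o G)// diff_comp//=.
by rewrite diff_grad diff_jac dot_mulmx.
Qed.

Lemma is_diff_sum (V W : normedModType R) n (G : 'I_n -> V -> W) x :
  (forall j, differentiable (G j) x) ->
  is_diff x (\sum_(j < n) G j) (\sum_(j < n) ('d (G j) x : V -> W)).
Proof.
move=> dG; elim/big_ind2 : _ => [|f df g dg|j _].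
- exact: is_diff_cst.
- exact: is_diffD.
- exact: differentiableP.
Qed.

Lemma differentiable_mean_map N M n (G : 'I_n -> 'rV[R]_N -> 'rV[R]_M) c x :
  (forall j, differentiable (G j) x) ->
  differentiable (fun x => c *: \sum_(j < n) G j x) x.
Proof.
move=> dG; rewrite (_ : (fun _ => _) = c *: \sum_(j < n) G j).
  by apply: differentiableZ; exact: differentiable_sum.
by apply/funext => y; rewrite fctE fct_sumE.
Qed.

Lemma jac_mean N M n (G : 'I_n -> 'rV[R]_N -> 'rV[R]_M) c x :
  (forall j, differentiable (G j) x) ->
  jac (fun x => c *: \sum_(j < n) G j x) x = c *: \sum_(j < n) jac (G j) x.
Proof.
move=> dG; apply: jac_unique => v.
rewrite (_ : (fun _ => _) = c *: \sum_(j < n) G j); last first.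
  by apply/funext => y; rewrite fctE fct_sumE.
rewrite diffZ /=; last exact: differentiable_sum.
rewrite linearZ -scalemxAr; congr (_ *: _).
have dS := is_diff_sum dG.
rewrite (@diff_val _ _ _ _ _ _ _ dS) fct_sumE.
rewrite linear_sum mulmx_sumr; apply: eq_bigr => j _; exact: diff_jac.
Qed.

Lemma differentiable_mean_fun N n (F : 'I_n -> 'rV[R]_N -> R) c x :
  (forall j, differentiable (F j : _ -> R^o) x) ->
  differentiable ((fun x => c * \sum_(j < n) F j x) : _ -> R^o) x.
Proof.
move=> dF; rewrite (_ : (fun _ => _) = c *: \sum_(j < n) (F j : _ -> R^o)).
  by apply: differentiableZ; exact: differentiable_sum.
by apply/funext => y; rewrite fctE fct_sumE.
Qed.

Lemma grad_mean N n (F : 'I_n -> 'rV[R]_N -> R) c x :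
  (forall j, differentiable (F j : _ -> R^o) x) ->
  grad (fun x => c * \sum_(j < n) F j x) x = c *: \sum_(j < n) grad (F j) x.
Proof.
move=> dF; apply: grad_unique => v.
rewrite (_ : (fun _ => _) = c *: \sum_(j < n) (F j : _ -> R^o)); last first.
  by apply/funext => y; rewrite fctE fct_sumE.
rewrite diffZ /=; last exact: differentiable_sum.
rewrite dotZl; congr (_ * _).
rewrite dotC dot_sumr; under [RHS]eq_bigr do rewrite dotC -diff_grad.
have dS := is_diff_sum (dF : forall j, differentiable (F j : _ -> R^o) x).
by rewrite (@diff_val _ _ _ _ _ _ _ dS) fct_sumE.
Qed.

(** * First-order inequalities along segments *)

Lemma is_derive_line N (phi : 'rV[R]_N -> R) (x p : 'rV[R]_N) (t : R) :
  differentiable (phi : _ -> R^o) (x + t *: p) ->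
  is_derive t 1 (fun s : R => phi (x + s *: p)) (dot (grad phi (x + t *: p)) p).
Proof.
move=> dphi.
pose k : R -> 'rV[R]_N := *:%R ^~ p.
have dk : is_diff t k k by exact: is_diff_scalel.
have dl : is_diff t (cst x + k) (0 + k) by exact: is_diffD.
have dc : differentiable ((phi : _ -> R^o) \o (cst x + k)) t.
  by apply: differentiable_comp => //; apply: ex_diff.
have -> : (fun s => phi (x + s *: p)) = (phi : _ -> R^o) \o (cst x + k).
  by apply/funext.
apply: DeriveDef; first exact: diff_derivable.
rewrite deriveE// diff_comp; [|exact: ex_diff|exact: dphi].
by rewrite /comp (@diff_val _ _ _ _ _ _ _ dl) diff_grad add0r /k scale1r.
Qed.

(** The mean value theorem is applied to phi along the segment minus a primitive of the assumed
    bound on its slope. With a = l |p|^2 this yields the descent lemma, with a = 0 a Lipschitz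
    bound. *)
Lemma mvt_line N (phi : 'rV[R]_N -> R) (x p : 'rV[R]_N) c (a : R) :
  (forall x, differentiable (phi : _ -> R^o) x) ->
  (forall t, 0 <= t <= 1 -> dot (grad phi (x + t *: p)) p <= c + a * t) ->
  phi (x + p) <= phi x + c + a / 2.
Proof.
move=> dphi dle.
pose psi (t : R) : R := phi (x + t *: p) - (t * c + a / 2 * t ^+ 2).
have dpsi (t : R) : is_derive t 1 psi (dot (grad phi (x + t *: p)) p - (c + a * t)).
  have := is_derive_line (dphi (x + t *: p)) => d1.
  rewrite /psi; apply: is_derive_eq.
  by rewrite /GRing.scale /=; field.
have := @MVT _ psi (fun t => dot (grad phi (x + t *: p)) p - (c + a * t)) 0 1 ltr01.
case=> //.
  apply: derivable_within_continuous => t _.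
  by have [] := dpsi t.
move=> t; rewrite in_itv /= => /andP[t0 t1].
rewrite /psi !scale0r !scale1r addr0 => E.
have /dle dt : 0 <= t <= 1 by rewrite !ltW.
move: E dt; set D := dot _ _; set f1 := phi _; set f0 := phi _ => E dt.
by have := mulr_ge0 (ltW t0) (ltW t0); lra.
Qed.

Lemma descent_lemma N l (phi : 'rV[R]_N -> R) (x y : 'rV[R]_N) :
  smooth_fun l phi ->
  phi y <= phi x + dot (grad phi x) (y - x) + l / 2 * dot (y - x) (y - x).
Proof.
move=> [dphi lphi]; set p := y - x.
rewrite -{1}(subrKC x y) -/p mulrAC.
apply: mvt_line => // t /andP[t0 t1].
rewrite -lerBlDl -dotNl -dotDl.
apply: (le_trans (cauchy_schwarz _ _)).
apply: (@le_trans _ _ (l * enorm (t *: p) * enorm p)).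
  rewrite ler_wpM2r ?enorm_ge0//.
  have xE : x + t *: p - x = t *: p by rewrite addrAC subrr add0r.
  by have := lphi (x + t *: p) x; rewrite xE.
by rewrite enormZ ger0_norm// -enorm_sqr expr2 le_eqVlt; apply/orP; left; apply/eqP; ring.
Qed.

Lemma smooth_funN N l (phi : 'rV[R]_N -> R) :
  smooth_fun l phi -> smooth_fun l (fun x => - phi x).
Proof.
move=> [dphi lphi].
have gN x : grad (fun x => - phi x) x = - grad phi x.
  apply: grad_unique => v.
  rewrite (_ : (fun x => - phi x : R^o) = - (phi : _ -> R^o))// diffN//.
  by rewrite dotNl -diff_grad.
split=> [x|x x']; last by rewrite !gN -opprD enormN.
exact: (@differentiableN _ _ _ (phi : _ -> R^o)).
Qed.

(** Stands in for dividing by t and letting t tend to 0 in first-order arguments. *)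
Lemma ler_of_quad_slack (a b c : R) :
  (forall t, 0 < t <= 1 -> t * a <= t * b + t ^+ 2 * c) -> a <= b.
Proof.
move=> abc; rewrite leNgt; apply/negP => ba.
have d_gt0 : 0 < a - b by rewrite subr_gt0.
have c_gt0 : 0 < c by have := abc 1; rewrite ltr01 lexx => /(_ isT); lra.
(* With this t, t c is at most half of a - b, whereas the hypothesis forces a - b <= t c. *)
pose t := Num.min 1 ((a - b) / (2 * c)).
have t_gt0 : 0 < t by rewrite lt_min ltr01 divr_gt0// mulr_gt0.
have t_le1 : t <= 1 by rewrite ge_min lexx.
have t_le : t * (2 * c) <= a - b.
  by rewrite -ler_pdivlMr ?mulr_gt0// ge_min lexx orbT.
have := abc t; rewrite t_gt0 t_le1 => /(_ isT).
by rewrite expr2 -mulrA -mulrDr ler_pM2l//; lra.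
Qed.

Lemma convex_functionP N (phi : 'rV[R]_N -> R) :
  convex_function [set: convex_lmodType 'rV[R]_N] phi ->
  forall x y t, 0 <= t <= 1 ->
  phi (t *: x + (1 - t) *: y) <= t * phi x + (1 - t) * phi y.
Proof.
move=> cphi x y t /andP[t0 t1].
have ht : Itv.spec (@Itv.num_sem R) (Itv.Real `[0%Z, 1%Z]) t.
  by apply/and3P; split; rewrite ?num_real ?bnd_simp//= ?in_itv ?t0.
by have := cphi (Itv.mk ht) x y; rewrite !in_setT => /(_ isT isT).
Qed.

(** Convexity bounds phi at x + t (y - x) from above, the descent lemma for - phi bounds it from
    below; the comparison loses only a term in t^2. *)
Lemma convex_grad_ineq N l (phi : 'rV[R]_N -> R) (x y : 'rV[R]_N) :
  convex_function [set: convex_lmodType 'rV[R]_N] phi -> smooth_fun l phi ->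
  phi x + dot (grad phi x) (y - x) <= phi y.
Proof.
move=> /convex_functionP cphi sphi; rewrite -lerBrDl.
apply: (@ler_of_quad_slack _ _ (l / 2 * dot (y - x) (y - x))) => t /andP[t0 t1].
have := descent_lemma x (x + t *: (y - x)) (smooth_funN sphi).
have gN : grad (fun x => - phi x) x = - grad phi x.
  apply: grad_unique => v.
  rewrite (_ : (fun x => - phi x : R^o) = - (phi : _ -> R^o))// diffN.
    by rewrite dotNl -diff_grad.
  by case: sphi.
have xE : x + t *: (y - x) - x = t *: (y - x) by rewrite addrAC subrr add0r.
have E : t *: y + (1 - t) *: x = x + t *: (y - x).
  by rewrite scalerBl scale1r scalerBr addrCA.
have /(cphi y x) : 0 <= t <= 1 by rewrite ltW.
rewrite E xE gN dotNl !dotZl !dotZr.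
move: (phi x) (phi y) (phi _) (dot _ _) (dot _ _).
by move=> a b c e g H C; rewrite expr2; lra.
Qed.

(** Arguing componentwise would cost a dimension factor. The scalar function v |-> <w, G v> with w =
    G x - G y keeps the constant b. *)
Lemma bounded_jac_lipschitz N M b (G : 'rV[R]_N -> 'rV[R]_M) (x y : 'rV[R]_N) :
  (forall x, differentiable G x) -> bounded_jac b G ->
  enorm (G x - G y) <= b * enorm (x - y).
Proof.
move=> dG bG; set w := G x - G y.
have [w0|w_neq0] := eqVneq (enorm w) 0.
  rewrite w0 mulr_ge0 ?enorm_ge0//.
  exact: le_trans (spectral_norm_ge0 _) (bG x).
have w_gt0 : 0 < enorm w by rewrite lt_def w_neq0 enorm_ge0.
have dw u : is_diff u (fun v : 'rV_M => dot w v : R^o) (fun v => dot w v).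
  have lw : linear (fun v : 'rV_M => dot w v : R^o).
    by move=> a u1 u2; rewrite dotDr dotZr.
  pose lM := GRing.isLinear.Build _ _ _ _ _ lw.
  pose L : {linear 'rV[R]_M -> R^o} := HB.pack (fun v => dot w v : R^o) lM.
  have cL : continuous L.
    apply: (@continuous_dot _ _ (cst w) id); first exact: cst_continuous.
    by move=> ?; exact: cvg_id.
  by apply: DiffDef; [exact: (@linear_differentiable _ _ _ L)|exact: (@diff_lin _ _ _ L)].
have dwG u : differentiable ((fun v => dot w v : R^o) \o G) u.
  by apply: differentiable_comp => //; exact: (@ex_diff _ _ _ _ _ _ _ (dw (G u))).
have gwG u : grad ((fun v => dot w v) \o G) u = w *m jac G u.
  rewrite grad_comp//.
  congr (_ *m _).
  by apply: grad_unique => v; rewrite (@diff_val _ _ _ _ _ _ _ (dw (G u))).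
have := @mvt_line _ ((fun v => dot w v) \o G) y (x - y)
  (enorm w * (b * enorm (x - y))) 0 dwG.
rewrite subrKC /= mul0r addr0 -lerBlDl -dotNr -dotDr -/w => H.
rewrite -(ler_pM2l w_gt0) -expr2 enorm_sqr; apply: H => t _.
rewrite gwG mul0r addr0 dot_mulmx; apply: (le_trans (cauchy_schwarz _ _)).
rewrite ler_wpM2l ?enorm_ge0// (le_trans (enorm_mulmx_tr _ _))//.
by rewrite ler_wpM2r ?enorm_ge0.
Qed.

End Gradients.

(** * Proximal steps *)

Section ProperClosedConvex.
Context {R : realType} {N : nat} (h : 'rV[R]_N -> \bar R).
Hypothesis h_pcc : proper_closed_convex h.

(** * Effective domain and existence of proximal points *)

Definition dom : set 'rV[R]_N := [set x | (h x < +oo)%E].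

Lemma dom_fineE x : dom x -> h x = (fine (h x))%:E.
Proof.
have [hNy _ _ _] := h_pcc; move=> xD; rewrite fineK//.
by rewrite fin_numE gt_eqF ?hNy// lt_eqF.
Qed.

Lemma epigraph_dom x r : (h x <= r%:E)%E -> dom x /\ fine (h x) <= r.
Proof.
move=> hr; have xD : dom x by exact: le_lt_trans hr (ltry _).
by split=> //; rewrite -lee_fin -dom_fineE.
Qed.

Lemma dom_conv x y t : dom x -> dom y -> 0 <= t <= 1 ->
  dom (t *: x + (1 - t) *: y) /\
  fine (h (t *: x + (1 - t) *: y)) <= t * fine (h x) + (1 - t) * fine (h y).
Proof.
move=> xD yD /andP[t0 t1]; have [_ _ _ cvx] := h_pcc.
have ht : Itv.spec (@Itv.num_sem R) (Itv.Real `[0%Z, 1%Z]) t.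
  by apply/and3P; split; rewrite ?num_real ?bnd_simp//= ?in_itv ?t0.
have := cvx (x, fine (h x)) (y, fine (h y)) (Itv.mk ht).
rewrite !in_setE /epigraph /= -!dom_fineE// !lexx => /(_ isT isT) /=.
exact: epigraph_dom.
Qed.

(** A closed epigraph amounts to lower semicontinuity: near each point h stays above some real r,
    and compactness makes the bound uniform. *)
Lemma lower_bound_compact K : compact K ->
  exists M : R, forall x, K x -> ((- M)%:E < h x)%E.
Proof.
have [hNy _ cl _] := h_pcc.
move=> /compact_near_coveringP/(_ _ (pinfty_nbhs R)
  (fun (M : R) x => (- M)%:E < h x)%E _) [].
  move=> x _.
  have [r rx] : exists r : R, (r%:E < h x)%E.
    have := hNy x; case: (h x) => [s _|_|//].
      by exists (s - 1); rewrite lte_fin; lra.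
    by exists 0; rewrite ltry.
  (* Since r < h x, the point (x, r) lies in the open complement of the epigraph. *)
  have : nbhs (x, (r : R^o)) (~` epigraph h).
    apply: open_nbhs_nbhs; split; first exact: closed_openC.
    by rewrite /epigraph /= => /(lt_le_trans rx); rewrite ltxx.
  move=> [[A B]] /= [xA rB] AB.
  exists (A, [set M | - r <= M]) => /=.
    by split=> //; apply: nbhs_pinfty_ge; rewrite num_real.
  move=> [x' M] /= [Ax' rM].
  apply: (@le_lt_trans _ _ r%:E); first by rewrite lee_fin lerNl.
  rewrite ltNge; apply/negP => hr; apply: (AB (x', r)) => //; split => //=.
  exact: nbhs_singleton.
move=> M [Mreal MK]; exists (M + 1); apply: MK.
by rewrite ltrDl.
Qed.

Definition box (c : R) : set 'rV[R]_N := [set v | forall i, v ord0 i \in `[- c, c]].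

Lemma compact_box c : compact (box c).
Proof.
apply: (@rV_compact _ _ (fun=> `[- c, c]%classic)) => _.
exact: segment_compact.
Qed.

Lemma enorm_box v c : enorm v <= c -> box c v.
Proof.
move=> vc i; rewrite in_itv /= -ler_norml (le_trans _ vc)//.
rewrite -ler_sqr ?nnegrE ?enorm_ge0// real_normK ?num_real// enorm_sqr /dot.
rewrite (bigD1 i)//= -expr2 lerDl sumr_ge0// => j _.
by rewrite -expr2 sqr_ge0.
Qed.

(* Convexity along the segment from x to y bounds h from below, linearly in the
   distance, by its values on the unit ball around x. *)
Lemma linear_lower_bound x : dom x -> exists M : R, forall y, dom y ->
  1 <= enorm (y - x) -> fine (h x) - M * enorm (y - x) <= fine (h y).
Proof.
move=> xD; have [M Mh] := lower_bound_compact (@compact_box (enorm x + 1)).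
exists (M + fine (h x)) => y yD t1; set t := enorm (y - x) in t1 *.
have t0 : 0 < t by lra.
have tV : 0 <= t^-1 <= 1 by rewrite invr_ge0 ltW//= invf_le1.
have [pD ple] := dom_conv yD xD tV.
set p := _ + _ in pD ple.
have pE : p = x + t^-1 *: (y - x).
  by rewrite /p scalerBl scale1r scalerBr addrCA.
have /Mh : box (enorm x + 1) p.
  apply: enorm_box; rewrite pE (le_trans (ler_enormD _ _))// lerD2l enormZ.
  by rewrite ger0_norm ?mulVf ?gt_eqF//; case/andP: tV.
rewrite (dom_fineE pD) lte_fin => /lt_le_trans/(_ ple).
rewrite -(ltr_pM2l t0) mulrDr mulrA mulfV ?gt_eqF// mul1r.
rewrite mulrA mulrBr mulr1 mulfV ?gt_eqF//.
by move=> H; lra.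
Qed.

(** The quadratic growth of q beats the at most linear decrease of h, so sublevel sets are bounded.
    Minimizing q plus the height over a compact piece of the epigraph replaces minimizing an
    extended-valued function by minimizing a continuous one. *)
Lemma exists_prox g z k : 0 < k -> exists w, minimizer
  (fun w => ((dot g w + k * enorm (w - z) ^+ 2)%:E + h w)%E) w.
Proof.
move=> k0; have [hNy [x xD] cl _] := h_pcc.
pose q w := dot g w + k * enorm (w - z) ^+ 2.
have qE w : q w = q x + dot (g + (2 * k) *: (x - z)) (w - x) + k * enorm (w - x) ^+ 2.
  rewrite /q !enorm_sqr !dotE (dotC z x) (dotC z w) (dotC x w); ring.
have q_cont : continuous q.
  have c1 : continuous (fun w : 'rV[R]_N => dot g w).
    apply: (@continuous_dot _ _ _ (cst g) id); first exact: cst_continuous.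
    by move=> ?; exact: cvg_id.
  have c2 : continuous (fun w : 'rV[R]_N => w - z).
    by move=> w; apply: (@continuousB _ _ _ id (cst z)) => //; exact: cst_continuous.
  have -> : q = (fun w => dot g w + k * dot (w - z) (w - z)).
    by apply/funext => w; rewrite /q enorm_sqr.
  move=> w.
  apply: (@continuousD _ R^o _ (dot g) (fun w => k * dot (w - z) (w - z))).
    exact: c1.
  have c3 := continuous_dot c2 c2.
  exact: (@cvgM _ _ _ _ (cst k) (fun w => dot (w - z) (w - z)) _ _ (cvg_cst k) (c3 w)).
have [M Mlin] := linear_lower_bound xD.
set b := enorm (g + (2 * k) *: (x - z)) in qE *.
have b0 : 0 <= b by exact: enorm_ge0.
have q_ge w : q x - b * enorm (w - x) + k * enorm (w - x) ^+ 2 <= q w.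
  rewrite (qE w) lerD2r lerD2l lerNl -dotNl (le_trans (cauchy_schwarz _ _))//.
  by rewrite enormN.
(* Beyond this radius the growth k t^2 exceeds the linear loss (b + M) t. *)
pose r := 1 + `|b + M| / k.
have r0 : 1 <= r by rewrite /r lerDl divr_ge0// ltW.
have sublevel w : dom w -> q w + fine (h w) <= q x + fine (h x) ->
    enorm (w - x) <= r.
  move=> wD le_w; have [t1|/ltW t1] := leP (enorm (w - x)) 1.
    exact: le_trans t1 r0.
  have := Mlin _ wD t1; have := q_ge w; set t := enorm (w - x) in t1 * => qw hw.
  have t0 : 0 < t by lra.
  have : t * (k * t) <= t * (b + M) by lra.
  rewrite ler_pM2l// => kt.
  have : t <= `|b + M| / k.
    by rewrite ler_pdivlMr// mulrC (le_trans kt)// ler_norm.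
  by rewrite /r; lra.
have [M2 M2h] := lower_bound_compact (@compact_box (enorm x + r)).
(* The upper height is what the sublevel condition leaves for h w once q w >= q x - b r is used. *)
pose E := epigraph h `&` (box (enorm x + r) `*` `[- M2, fine (h x) + b * r]%classic).
have E_ge w : dom w -> q w + fine (h w) <= q x + fine (h x) -> E (w, fine (h w)).
  move=> wD le_w; have wr := sublevel _ wD le_w.
  have wbox : box (enorm x + r) w.
    by apply: enorm_box; rewrite -(subrKC x w) (le_trans (ler_enormD _ _))// lerD2l.
  split; first by rewrite /epigraph /= -dom_fineE.
  split=> //=; rewrite in_itv /=; apply/andP; split.
    by have := M2h _ wbox; rewrite (dom_fineE wD) lte_fin => /ltW.
  have := q_ge w; have := ler_wpM2l b0 wr.
  have := mulr_ge0 (ltW k0) (sqr_ge0 (enorm (w - x))).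
  by move: le_w; lra.
have xE : E (x, fine (h x)) by exact: E_ge.
have cE : compact E.
  rewrite /E setIC; apply: compact_closedI => //.
  by apply: compact_setX; [exact: compact_box|exact: segment_compact].
have [|[w s]] := @compact_EVT_min _ _ (fun p : 'rV[R]_N * R^o => q p.1 + p.2) E
  (ex_intro _ _ xE) cE.
  apply: continuous_subspaceT => p.
  apply: (@continuousD _ R^o _ (fun p : 'rV[R]_N * R^o => q p.1) snd).
    apply: (@continuous_comp _ _ _ (fst : 'rV[R]_N * R^o -> _) q); last exact: q_cont.
    exact: cvg_fst.
  exact: cvg_snd.
rewrite inE => -[/epigraph_dom[/= wD hs] _] w_min; exists w => w'.
rewrite -[dot g w + _]/(q w) -[dot g w' + _]/(q w').
have [w'D|] := pselect (dom w'); last first.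
  move/negP; rewrite -leNgt leye_eq => /eqP ->.
  by rewrite addey// leey.
rewrite (dom_fineE wD) (dom_fineE w'D) -!EFinD lee_fin.
have := w_min (x, fine (h x)); rewrite inE => /(_ xE) /= le_x.
have [le_w'|lt_w'] := leP (q w' + fine (h w')) (q x + fine (h x)).
  by have := w_min (w', fine (h w')); rewrite inE => /(_ (E_ge _ w'D le_w')) /=; lra.
by lra.
Qed.

(** * Optimality conditions at proximal points *)

Lemma minimizer_dom (q : 'rV[R]_N -> R) x :
  minimizer (fun w => ((q w)%:E + h w)%E) x -> dom x.
Proof.
have [_ [x0 x0D] _ _] := h_pcc => /(_ x0) x_min.
have : ((q x)%:E + h x < +oo)%E.
  by apply: (le_lt_trans x_min); rewrite (dom_fineE x0D) -EFinD ltry.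
by rewrite /dom /=; case: (h x) => [s _|//|//]; rewrite ltry.
Qed.

(** Fermat's rule for q + h: from x towards w by a fraction t, the upper model of q errs by t^2
    only, and h is convex. The model is an equality for a proximal objective and is the descent
    lemma for f. *)
Lemma minimizer_subgradient (q : 'rV[R]_N -> R) x g c :
  minimizer (fun w => ((q w)%:E + h w)%E) x ->
  (forall p, q (x + p) <= q x + dot g p + c * dot p p) ->
  subgradient h x (- g).
Proof.
move=> x_min q_le w; have xD := minimizer_dom x_min.
have [wD|] := pselect (dom w); last first.
  by move/negP; rewrite -leNgt leye_eq => /eqP ->; rewrite leey.
rewrite (dom_fineE xD) (dom_fineE wD) -EFinD lee_fin dotNl.
apply: (@ler_of_quad_slack _ _ _ (c * dot (w - x) (w - x))) => t /andP[t0 t1].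
have t01 : 0 <= t <= 1 by rewrite ltW.
have [pD ple] := dom_conv wD xD t01.
have pE : t *: w + (1 - t) *: x = x + t *: (w - x).
  by rewrite scalerBl scale1r scalerBr addrCA.
have := x_min (t *: w + (1 - t) *: x).
rewrite (dom_fineE xD) (dom_fineE pD) -!EFinD lee_fin => H.
have := q_le (t *: (w - x)); rewrite -pE !dotZr !dotZl => {}q_le.
move: H q_le ple; move: (q x) (q _) (dot _ _) (dot _ _) (fine _) (fine _) (fine _).
by move=> a1 a2 a3 a4 a5 a6 a7 H1 H2 H3; rewrite expr2 /=; lra.
Qed.

Variables (mu : R).
Hypothesis h_strong : strongly_convex mu h.

Lemma strongly_convex_minimizer (q : 'rV[R]_N -> R) x g c w :
  minimizer (fun w => ((q w)%:E + h w)%E) x ->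
  (forall p, q (x + p) <= q x + dot g p + c * dot p p) -> dom w ->
  fine (h x) - dot g (w - x) + mu / 2 * dot (w - x) (w - x) <= fine (h w).
Proof.
move=> x_min q_le wD; have xD := minimizer_dom x_min.
have := h_strong w (minimizer_subgradient x_min q_le).
by rewrite (dom_fineE xD) (dom_fineE wD) -EFinD lee_fin dotNl enorm_sqr addrA.
Qed.

(** The proximal objective has strong convexity modulus 2 k + mu, hence this growth around its
    minimizer. [exists_prox] rules out the default value of [argmin]. *)
Lemma argmin_proxP g z k : 0 < k ->
  let w := argmin (fun w => ((dot g w + k * enorm (w - z) ^+ 2)%:E + h w)%E) in
  dom w /\ forall u, dom u ->
  dot g w + k * dot (w - z) (w - z) + fine (h w)
    + (k + mu / 2) * dot (u - w) (u - w)
  <= dot g u + k * dot (u - z) (u - z) + fine (h u).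
Proof.
move=> k0 w.
have w_min : minimizer (fun w => ((dot g w + k * enorm (w - z) ^+ 2)%:E + h w)%E) w.
  by have [v vmin] := exists_prox g z k0; apply: (xgetPex 0); exists v.
split=> [|u uD]; first exact: minimizer_dom w_min.
have q_le p : dot g (w + p) + k * enorm (w + p - z) ^+ 2 <=
    dot g w + k * enorm (w - z) ^+ 2 + dot (g + (2 * k) *: (w - z)) p + k * dot p p.
  rewrite !enorm_sqr !dotE (dotC z w) (dotC z p) (dotC p w).
  by rewrite le_eqVlt; apply/orP; left; apply/eqP; ring.
have := strongly_convex_minimizer w_min q_le uD.
rewrite !dotE (dotC z w) (dotC z u) (dotC u w).
set a1 := dot _ _; set a2 := dot _ _; set a3 := dot _ _; set a4 := dot _ _.
set a5 := dot _ _; set a6 := dot _ _; set a7 := dot _ _; set a8 := dot _ _.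
by move=> H; lra.
Qed.

End ProperClosedConvex.

(** * Uniform expectations *)

Section UniformMean.
Context {R : realType}.

Definition umean (T : finType) (X : T -> R) : R := #|T|%:R^-1 * \sum_(w : T) X w.

Lemma expectation_unif_EFin (T : finType) (X : T -> R) :
  expectation_unif (fun w => (X w)%:E) = (umean X)%:E.
Proof. by rewrite /expectation_unif sumEFin. Qed.

Lemma eq_umean (T : finType) (X Y : T -> R) : X =1 Y -> umean X = umean Y.
Proof. by move=> XY; congr (_ * _); exact: eq_bigr. Qed.

Lemma le_umean (T : finType) (X Y : T -> R) :
  (forall w, X w <= Y w) -> umean X <= umean Y.
Proof.
by move=> XY; rewrite ler_wpM2l ?invr_ge0 ?ler0n//; apply: ler_sum.
Qed.

Lemma umeanD (T : finType) (X Y : T -> R) :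
  umean (fun w => X w + Y w) = umean X + umean Y.
Proof. by rewrite /umean big_split mulrDr. Qed.

Lemma umeanZ (T : finType) c (X : T -> R) : umean (fun w => c * X w) = c * umean X.
Proof. by rewrite /umean -mulr_sumr mulrCA. Qed.

Lemma umean_cst (T : finType) c : (0 < #|T|)%N -> umean (fun _ : T => c) = c.
Proof.
move=> T0; rewrite /umean sumr_const -[c *+ _]mulr_natl mulKf//.
by rewrite pnatr_eq0 -lt0n.
Qed.

Lemma umean_le_cst (T : finType) c (X : T -> R) :
  (0 < #|T|)%N -> (forall w, X w <= c) -> umean X <= c.
Proof. by move=> T0 Xc; rewrite -(umean_cst c T0); exact: le_umean. Qed.

Lemma umean_pair (T1 T2 : finType) (X : T1 * T2 -> R) :
  umean X = umean (fun a => umean (fun b => X (a, b))).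
Proof.
rewrite /umean card_prod natrM invfM -mulr_sumr mulrA.
by rewrite (pair_big xpredT xpredT (fun a b => X (a, b)))/=; congr (_ * _);
  apply: eq_bigr => -[].
Qed.

Lemma umean_exchange (T1 T2 : finType) (X : T1 -> T2 -> R) :
  umean (fun a => umean (fun b => X a b)) = umean (fun b => umean (fun a => X a b)).
Proof.
rewrite /umean -!mulr_sumr exchange_big/= mulrCA; do 2 congr (_ * _).
Qed.

Lemma umean_bij (T1 T2 : finType) (f : T1 -> T2) (X : T2 -> R) :
  bijective f -> umean X = umean (X \o f).
Proof.
move=> bf; rewrite /umean (bij_eq_card bf); congr (_ * _).
by rewrite (reindex f)//; exact: onW_bij.
Qed.

Lemma umean_tuple0 (T : finType) (X : 0.-tuple T -> R) : umean X = X [tuple].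
Proof.
rewrite -(@umean_cst [the finType of 0.-tuple T] (X [tuple])).
  by apply: eq_umean => w; rewrite tuple0.
by rewrite card_tuple.
Qed.

(** Tower property for successive independent draws; every induction on the number of samples or
    loops goes through it. *)
Lemma umean_tupleS (T : finType) n (X : n.+1.-tuple T -> R) :
  umean X = umean (fun d => umean (fun w : n.-tuple T => X [tuple of d :: w])).
Proof.
rewrite -(umean_pair (fun p : T * n.-tuple T => X [tuple of p.1 :: p.2])).
apply: (@umean_bij _ _ (fun p : T * n.-tuple T => [tuple of p.1 :: p.2])).
exists (fun w : n.+1.-tuple T => (thead w, [tuple of behead w])) => [[d w]|w] /=.
  by rewrite theadE; congr (_, _); apply/val_inj.
by rewrite -tuple_eta.
Qed.

Lemma umean_dot0 N n (xi : 'I_n -> 'rV[R]_N) v :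
  \sum_(i < n) xi i = 0 -> umean (fun i => dot (xi i) v) = 0.
Proof.
move=> xi0; rewrite /umean; under eq_bigr do rewrite dotC.
by rewrite -dot_sumr xi0 dotC dot0l mulr0.
Qed.

Lemma umean_sqr_sum N n (xi : 'I_n -> 'rV[R]_N) A :
  (0 < n)%N -> \sum_(i < n) xi i = 0 ->
  umean (fun t : A.-tuple 'I_n => dot (\sum_(i <- t) xi i) (\sum_(i <- t) xi i))
  = A%:R * umean (fun i => dot (xi i) (xi i)).
Proof.
move=> n0 xi0; have cT k : (0 < #|{: k.-tuple 'I_n}|)%N.
  by rewrite card_tuple card_ord expn_gt0 n0.
elim: A => [|A IH]; first by rewrite umean_tuple0 big_nil dot0l mul0r.
rewrite umean_tupleS -natr1 mulrDl mul1r -IH addrC.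
rewrite -[X in _ + X](@umean_cst 'I_n) ?card_ord// -umeanD.
transitivity (umean (fun d => umean (fun w : A.-tuple 'I_n =>
    dot (xi d) (xi d) + dot (\sum_(i <- w) xi i) (\sum_(i <- w) xi i)) +
    umean (fun w : A.-tuple 'I_n => 2 * dot (xi d) (\sum_(i <- w) xi i)))).
  apply: eq_umean => d; rewrite -umeanD; apply: eq_umean => w.
  by rewrite /= big_cons !dotE (dotC _ (xi d)); ring.
(* The cross term vanishes once the new sample d is averaged first, because the [xi] sum to zero. *)
rewrite umeanD [X in _ + X]umean_exchange [X in _ + X](_ : _ = 0) ?addr0.
  by apply: eq_umean => d; rewrite umeanD umean_cst.
by rewrite -(@umean_cst _ 0 (cT A)); apply: eq_umean => w; rewrite umeanZ umean_dot0// mulr0.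
Qed.

(** A mean of A independent samples has 1/A of the variance of one sample, and that variance is at
    most the second moment. *)
Lemma umean_variance_le N n (xi : 'I_n -> 'rV[R]_N) A c :
  (0 < n)%N -> (0 < A)%N -> (forall i, dot (xi i) (xi i) <= c) ->
  umean (fun t : A.-tuple 'I_n =>
    let e := A%:R^-1 *: \sum_(i <- t) xi i - n%:R^-1 *: \sum_(i < n) xi i in
    dot e e) <= c / A%:R.
Proof.
move=> n0 A0 xic; set m := n%:R^-1 *: _.
have n0R : n%:R != 0 :> R by rewrite pnatr_eq0 -lt0n.
have A0R : A%:R != 0 :> R by rewrite pnatr_eq0 -lt0n.
have sxi : \sum_(i < n) xi i = n%:R *: m by rewrite /m scalerA mulfV// scale1r.
clearbody m; pose eta i := xi i - m.
have eta0 : \sum_(i < n) eta i = 0.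
  by rewrite /eta sumrB sxi sumr_const card_ord scaler_nat subrr.
rewrite (_ : umean _ = A%:R^-1 ^+ 2 * umean (fun t : A.-tuple 'I_n =>
    dot (\sum_(i <- t) eta i) (\sum_(i <- t) eta i))); last first.
  rewrite -umeanZ; apply: eq_umean => t /=.
  have -> : A%:R^-1 *: \sum_(i <- t) xi i - m = A%:R^-1 *: \sum_(i <- t) eta i.
    rewrite /eta sumrB big_const_seq count_predT size_tuple iter_addr_0.
    by rewrite scalerBr -[m *+ A]scaler_nat scalerA mulVf// scale1r.
  by rewrite dotZl dotZr mulrA.
rewrite umean_sqr_sum// expr2 -mulrA mulKf// mulrC.
rewrite ler_wpM2r ?invr_ge0 ?ler0n//.
have -> : umean (fun i => dot (eta i) (eta i)) =
    umean (fun i => dot (xi i) (xi i)) - dot m m.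
  rewrite (_ : umean _ = umean (fun i => dot (xi i) (xi i) +
     ((- 2) * dot (eta i) m + (- dot m m)))); last first.
    by apply: eq_umean => i; rewrite /eta !dotE (dotC m); ring.
  by rewrite !umeanD umeanZ umean_dot0// mulr0 add0r umean_cst ?card_ord.
have := umean_le_cst (_ : (0 < #|'I_n|)%N) xic.
rewrite card_ord => /(_ n0); have := dot_ge0 m; lra.
Qed.

End UniformMean.

(** * The gradient estimator *)

Section Estimator.
(* Keeps unification from unfolding differentials when it compares derivatives
   at different points. *)
Local Opaque jac grad.

Context {R : realType} {N1 N2 n1 n2 : nat}.
Variables (F : 'I_n1 -> 'rV[R]_N1 -> R) (G : 'I_n2 -> 'rV[R]_N2 -> 'rV[R]_N1).
Variables (L LF BF LG BG : R).
Hypotheses (n1_gt0 : (0 < n1)%N) (n2_gt0 : (0 < n2)%N).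
Hypothesis F_smooth : forall i, smooth_fun LF (F i).
Hypothesis F_bounded : forall i, bounded_grad BF (F i).
Hypothesis G_smooth : forall j, smooth_map LG (G j).
Hypothesis G_bounded : forall j, bounded_jac BG (G j).
Hypothesis FG_lip : forall i j x y,
  enorm (grad (F i) (meanG G x) *m jac (G j) x
         - grad (F i) (meanG G y) *m jac (G j) y) <= L * enorm (x - y).

Let dF i x : differentiable (F i : _ -> R^o) x. Proof. by case: (F_smooth i). Qed.
Let dG j x : differentiable (G j) x. Proof. by case: (G_smooth j). Qed.

Lemma jac_meanG x : jac (meanG G) x = n2%:R^-1 *: \sum_(j < n2) jac (G j) x.
Proof. exact: jac_mean. Qed.

Lemma mulmx_jac_mean (v : 'rV[R]_N1) x :
  v *m jac (meanG G) x = n2%:R^-1 *: \sum_(j < n2) v *m jac (G j) x.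
Proof. by rewrite jac_meanG -(scalemxAr _ v) mulmx_sumr. Qed.

Lemma differentiable_objf x : differentiable (objf F G : _ -> R^o) x.
Proof.
apply: (@differentiable_comp _ _ _ R^o (meanG G) (meanF F)).
  exact: differentiable_mean_map.
exact: differentiable_mean_fun.
Qed.

Lemma grad_objf x : grad (objf F G) x =
  n1%:R^-1 *: \sum_(i < n1) (grad (F i) (meanG G x) *m jac (meanG G) x).
Proof.
rewrite (_ : objf F G = meanF F \o meanG G)// grad_comp.
- by rewrite grad_mean// -scalemxAl mulmx_suml.
- exact: differentiable_mean_map.
- exact: differentiable_mean_fun.
Qed.

Lemma grad_comp_mean_lip i x y :
  enorm (grad (F i) (meanG G x) *m jac (meanG G) x
         - grad (F i) (meanG G y) *m jac (meanG G) y) <= L * enorm (x - y).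
Proof.
rewrite [X in enorm (X - _)]mulmx_jac_mean [X in enorm (_ - X)]mulmx_jac_mean.
rewrite -scalerBr -sumrB.
by apply: ler_enorm_mean => //; rewrite /index_enum -enumT size_enum_ord.
Qed.

(** The constant L is inherited from [FG_lip] by averaging over j and then over i. *)
Lemma objf_smooth : smooth_fun L (objf F G).
Proof.
split; first exact: differentiable_objf.
move=> x y; rewrite !grad_objf -scalerBr -sumrB.
apply: ler_enorm_mean => //; first by rewrite /index_enum -enumT size_enum_ord.
by move=> i; exact: grad_comp_mean_lip.
Qed.

Lemma enorm_mulmx_jac_mean x w : enorm (w *m jac (meanG G) x) <= BG * enorm w.
Proof.
rewrite mulmx_jac_mean.
apply: ler_enorm_mean => //; first by rewrite /index_enum -enumT size_enum_ord.
move=> j; apply: (le_trans (enorm_mulmx _ _)).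
by rewrite ler_wpM2r ?enorm_ge0//; exact: G_bounded.
Qed.

(** * Mean squared error of the estimator at fixed points *)

Variables (A B C : nat) (xt x : 'rV[R]_N2).
Hypotheses (A_gt0 : (0 < A)%N) (B_gt0 : (0 < B)%N) (C_gt0 : (0 < C)%N).

Let delta := dot (x - xt) (x - xt).

Let ord1_gt0 : (0 < #|'I_n1|)%N. Proof. by rewrite card_ord. Qed.
Let ord2_gt0 : (0 < #|'I_n2|)%N. Proof. by rewrite card_ord. Qed.

Let card_tuple_gt0 (T : finType) k : (0 < #|T|)%N -> (0 < #|{: k.-tuple T}|)%N.
Proof. by rewrite card_tuple expn_gt0 => ->. Qed.

Lemma card_draw_gt0 : (0 < #|@draw n1 n2 A B C|)%N.
Proof. by rewrite !card_prod !muln_gt0 !card_tuple_gt0. Qed.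

Lemma mulmx_mean_affine p q (I : Type) (r : seq I) c (v : 'rV[R]_p)
    (D : I -> 'M[R]_(p, q)) J1 J2 :
  v *m (c *: \sum_(i <- r) D i + J1 - J2) =
  c *: (\sum_(i <- r) v *m D i) + v *m J1 - v *m J2.
Proof. by rewrite mulmxBr mulmxDr -scalemxAr mulmx_sumr. Qed.

(** Separates the three sources of error: Jacobian batch, inner-value batch, outer batch. The
    indices 1, 2, 3 stand for estimated quantities, exact ones at x and exact ones at the
    snapshot. *)
Lemma mean_mulmx_split p q (I : Type) (r : seq I) k (g1 g2 g3 : I -> 'rV[R]_p)
    (J1 J2 J3 : 'M[R]_(p, q)) f2 f3 :
  k *: \sum_(i <- r) (g1 i *m J1 - g3 i *m J3) + f3 - f2 =
  (k *: \sum_(i <- r) g1 i) *m (J1 - J2) +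
  (k *: \sum_(i <- r) (g1 i - g2 i)) *m J2 +
  (k *: \sum_(i <- r) (g2 i *m J2 - g3 i *m J3) - (f2 - f3)).
Proof.
rewrite !sumrB -!mulmx_suml mulmxBr -!scalemxAl mulmxBl.
by apply/rowP => i; rewrite !mxE; ring.
Qed.

Lemma est_G_error : umean (fun t : A.-tuple 'I_n2 =>
  let e := A%:R^-1 *: \sum_(i <- t) (G i x - G i xt) + meanG G xt - meanG G x in
  dot e e) <= BG ^+ 2 * delta / A%:R.
Proof.
rewrite (_ : umean _ = umean (fun t : A.-tuple 'I_n2 =>
   let e := A%:R^-1 *: \sum_(i <- t) (G i x - G i xt) -
     n2%:R^-1 *: \sum_(i < n2) (G i x - G i xt) in dot e e)).
  apply: umean_variance_le => // i.
  rewrite /delta -[dot (x - xt) _]enorm_sqr -exprMn; apply: dot_le_sqr.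
  exact: bounded_jac_lipschitz.
apply: eq_umean => t /=.
suff -> : meanG G x = n2%:R^-1 *: (\sum_(i < n2) (G i x - G i xt)) + meanG G xt.
  by rewrite opprD addrACA subrr addr0.
by rewrite /meanG sumrB scalerBr subrK.
Qed.

Lemma est_jacG_error (v : 'rV[R]_N1) : enorm v <= BF ->
  umean (fun t : B.-tuple 'I_n2 =>
    let e := v *m (B%:R^-1 *: \sum_(i <- t) (jac (G i) x - jac (G i) xt)
                   + jac (meanG G) xt - jac (meanG G) x) in
    dot e e) <= (BF * LG) ^+ 2 * delta / B%:R.
Proof.
move=> vBF.
rewrite (_ : umean _ = umean (fun t : B.-tuple 'I_n2 =>
   let e := B%:R^-1 *: \sum_(i <- t) (v *m (jac (G i) x - jac (G i) xt)) -
     n2%:R^-1 *: \sum_(i < n2) (v *m (jac (G i) x - jac (G i) xt)) in dot e e)).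
  apply: umean_variance_le => // i.
  rewrite /delta -[dot (x - xt) _]enorm_sqr -exprMn; apply: dot_le_sqr.
  apply: (le_trans (enorm_mulmx _ _)); rewrite -mulrA [leRHS]mulrC.
  apply: ler_pM => //; [exact: spectral_norm_ge0|exact: enorm_ge0|].
  by case: (G_smooth i).
apply: eq_umean => t.
apply: (congr1 (fun w => dot w w)); rewrite [LHS]mulmx_mean_affine.
have vJ : v *m jac (meanG G) x =
    n2%:R^-1 *: (\sum_(i < n2) v *m (jac (G i) x - jac (G i) xt))
    + v *m jac (meanG G) xt.
  rewrite [LHS]mulmx_jac_mean [X in _ + X]mulmx_jac_mean -scalerDr -big_split.
  by congr (_ *: _); apply: eq_bigr => i _ /=; rewrite mulmxBr subrK.
by rewrite [X in _ - X]vJ opprD addrACA subrr addr0.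
Qed.

Lemma est_outer_error : umean (fun t : C.-tuple 'I_n1 =>
  let e := C%:R^-1 *: \sum_(i <- t)
      (grad (F i) (meanG G x) *m jac (meanG G) x
       - grad (F i) (meanG G xt) *m jac (meanG G) xt)
    - (grad (objf F G) x - grad (objf F G) xt) in
  dot e e) <= L ^+ 2 * delta / C%:R.
Proof.
rewrite !grad_objf -scalerBr -sumrB.
apply: umean_variance_le => // i.
rewrite /delta -[dot (x - xt) _]enorm_sqr -exprMn; apply: dot_le_sqr.
exact: grad_comp_mean_lip.
Qed.

(* The Jacobian error is only ever multiplied by a vector that does not depend
   on the batch used for the Jacobian, which is what allows a variance bound in
   terms of spectral norms without any dimension factor. *)
Lemma est_grad_error : umean (fun d : @draw n1 n2 A B C =>
    let e := est_grad F G d xt x - grad (objf F G) x in dot e e) <=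
  3 * ((BF * LG) ^+ 2 / B%:R + BG ^+ 4 * LF ^+ 2 / A%:R + L ^+ 2 / C%:R) * delta.
Proof.
pose v (d : @draw n1 n2 A B C) := C%:R^-1 *: \sum_(i <- d.2) grad (F i) (est_G G d xt x).
pose a d := v d *m (est_jacG G d xt x - jac (meanG G) x).
pose b (d : @draw n1 n2 A B C) := (C%:R^-1 *: \sum_(i <- d.2)
  (grad (F i) (est_G G d xt x) - grad (F i) (meanG G x))) *m jac (meanG G) x.
pose c (d : @draw n1 n2 A B C) := C%:R^-1 *: \sum_(i <- d.2)
      (grad (F i) (meanG G x) *m jac (meanG G) x
       - grad (F i) (meanG G xt) *m jac (meanG G) xt)
    - (grad (objf F G) x - grad (objf F G) xt).
have errE d : est_grad F G d xt x - grad (objf F G) x = a d + b d + c d by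
  exact: mean_mulmx_split.
have aP : umean (fun d => dot (a d) (a d)) <= (BF * LG) ^+ 2 * delta / B%:R.
  rewrite !umean_pair /=.
  apply: umean_le_cst => [|tA]; first exact: card_tuple_gt0.
  (* With the batches for G and F frozen, the averaged gradient is a fixed vector and only the
     Jacobian batch is averaged. *)
  rewrite umean_exchange.
  apply: umean_le_cst => [|tC]; first exact: card_tuple_gt0.
  pose w := C%:R^-1 *: \sum_(i <- tC) grad (F i)
    (A%:R^-1 *: \sum_(j <- tA) (G j x - G j xt) + meanG G xt).
  have wBF : enorm w <= BF.
    by apply: ler_enorm_mean => //; [rewrite size_tuple|move=> i; exact: F_bounded].
  exact: (est_jacG_error wBF).
have bP : umean (fun d => dot (b d) (b d)) <= BG ^+ 4 * LF ^+ 2 * delta / A%:R.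
  rewrite (_ : _ / _ = (BG * LF) ^+ 2 * (BG ^+ 2 * delta / A%:R)); last by ring.
  (* Pathwise, smoothness of the F_i bounds this part by BG LF times the error of [est_G], whatever
     the other two batches are. *)
  apply: (@le_trans _ _ ((BG * LF) ^+ 2 * umean (fun t : A.-tuple 'I_n2 =>
    let e := A%:R^-1 *: \sum_(i <- t) (G i x - G i xt) + meanG G xt - meanG G x in
    dot e e))); last by rewrite ler_wpM2l ?sqr_ge0//; exact: est_G_error.
  rewrite -umeanZ !umean_pair /=; apply: le_umean => tA.
  apply: umean_le_cst => [|tB]; first exact: card_tuple_gt0.
  apply: umean_le_cst => [|tC]; first exact: card_tuple_gt0.
  rewrite -[X in _ <= _ * X]enorm_sqr -exprMn; apply: dot_le_sqr; rewrite /b /=.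
  apply: (le_trans (enorm_mulmx_jac_mean _ _)).
  rewrite -mulrA ler_wpM2l//.
    exact: le_trans (spectral_norm_ge0 _) (G_bounded (Ordinal n2_gt0) x).
  apply: ler_enorm_mean => //; first by rewrite size_tuple.
  by move=> i; case: (F_smooth i).
have cP : umean (fun d => dot (c d) (c d)) <= L ^+ 2 * delta / C%:R.
  rewrite umean_pair; apply: umean_le_cst => [|tAB]; last exact: est_outer_error.
  by rewrite card_prod muln_gt0 !card_tuple_gt0.
apply: (@le_trans _ _ (3 * (umean (fun d => dot (a d) (a d)) +
    umean (fun d => dot (b d) (b d)) + umean (fun d => dot (c d) (c d))))).
  rewrite -!umeanD -umeanZ; apply: le_umean => d /=.
  by rewrite errE dot_sqrD3_le.
lra.
Qed.

End Estimator.

(** * One accelerated step *)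

Section CompositeStep.
Context {R : realType} {N : nat} (f : 'rV[R]_N -> R) (h : 'rV[R]_N -> \bar R).
Variables (L mu : R).
Hypothesis f_convex : convex_function [set: convex_lmodType 'rV[R]_N] f.
Hypothesis f_smooth : smooth_fun L f.
Hypothesis h_pcc : proper_closed_convex h.
Hypothesis mu_ge0 : 0 <= mu.
Hypothesis h_strong : strongly_convex mu h.

(** [fine] makes H real-valued, so that linear arithmetic applies; it is the true objective on
    [dom h]. *)
Definition composite (w : 'rV[R]_N) : R := f w + fine (h w).

Local Notation H := composite.

Lemma composite_conv x y t : dom h x -> dom h y -> 0 <= t <= 1 ->
  H (t *: x + (1 - t) *: y) <= t * H x + (1 - t) * H y.
Proof.
move=> xD yD t01; have [_ hle] := dom_conv h_pcc xD yD t01.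
by have := convex_functionP f_convex x y t01; rewrite /H; lra.
Qed.

Lemma composite_jensen n (w : nat -> R) (y : nat -> 'rV[R]_N) :
  (0 < n)%N -> (forall j, 0 < w j) -> (forall j, (j < n)%N -> dom h (y j)) ->
  let W := \sum_(j < n) w j in let v := W^-1 *: \sum_(j < n) w j *: y j in
  [/\ 0 < W, dom h v & W * H v <= \sum_(j < n) w j * H (y j)].
Proof.
case: n => // n _ w0; elim: n => [|n IH] yD /=.
  rewrite !big_ord1 scalerA mulVf ?gt_eqF// scale1r.
  by split; [exact: w0|exact: yD|exact: lexx].
rewrite big_ord_recr [X in _ *: X]big_ord_recr [leRHS]big_ord_recr /=.
have [] := IH (fun j jn => yD j (ltnW jn)).
set W := \sum_(j < _) _; set V := \sum_(j < _) _ *: _; set HS := \sum_(j < _) _ => /= W0 vD Hv.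
set a := w n.+1; have a0 : 0 < a by exact: w0.
have Wa0 : 0 < W + a by exact: addr_gt0.
have t01 : 0 <= W / (W + a) <= 1.
  by rewrite ler_pdivrMr// mul1r lerDl divr_ge0 ?ltW.
have tC : 1 - W / (W + a) = a / (W + a) by field; rewrite gt_eqF.
have vE : (W + a)^-1 *: (V + a *: y n.+1) =
    (W / (W + a)) *: (W^-1 *: V) + (1 - W / (W + a)) *: y n.+1.
  by rewrite tC scalerDr !scalerA [W / _ / W]mulrAC mulfV ?gt_eqF// mul1r (mulrC a).
have yDn : dom h (y n.+1) by exact: yD.
have [cD _] := dom_conv h_pcc vD yDn t01.
split=> //; rewrite vE//.
have := composite_conv vD yDn t01; rewrite -vE tC.
rewrite -(ler_pM2l Wa0) => /le_trans; apply.
rewrite [leLHS](_ : _ = W * H (W^-1 *: V) + a * H (y n.+1)); first by rewrite lerD2r.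
by field; rewrite gt_eqF.
Qed.

(** At the minimizer - grad f u is a subgradient of h. Strong convexity of h there and the gradient
    inequality for f add up, and the gradient terms cancel. *)
Lemma composite_growth u w : minimizer (fun w => ((f w)%:E + h w)%E) u ->
  dom h w -> mu / 2 * dot (u - w) (u - w) <= H w - H u.
Proof.
move=> u_min wD.
have q_le p : f (u + p) <= f u + dot (grad f u) p + L / 2 * dot p p.
  have := descent_lemma u (u + p) f_smooth.
  by have -> : u + p - u = p by rewrite addrAC subrr add0r.
have := strongly_convex_minimizer h_pcc h_strong u_min q_le wD.
have := convex_grad_ineq u w f_convex f_smooth.
rewrite -(opprB w u) dotNl dotNr opprK /H; lra.
Qed.

(* One accelerated step with an arbitrary gradient estimate g at x.  The test
   point of the proximal step for y' is v = tau1 z' + tau2 xt + tau3 y, for which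
   v - x = tau1 (z' - z), so that the quadratic terms of the two proximal
   inequalities cancel. *)
Lemma accelerated_step tau1 tau2 (g xt y z u : 'rV[R]_N) :
  0 < L -> 0 < tau1 -> 0 <= tau2 -> tau1 + tau2 <= 1 ->
  dom h xt -> dom h y -> dom h u ->
  let tau3 := 1 - tau1 - tau2 in
  let k := 3 * tau1 * L / 2 in
  let x := tau1 *: z + tau2 *: xt + tau3 *: y in
  let z' := argmin (fun w => ((dot g w + k * enorm (w - z) ^+ 2)%:E + h w)%E) in
  let y' := argmin (fun w => ((dot g w + 3 * L / 2 * enorm (w - x) ^+ 2)%:E + h w)%E) in
  let e := g - grad f x in
  [/\ dom h y', dom h z' &
  H y' - H u + tau1 * (k + mu / 2) * dot (u - z') (u - z')
  <= tau2 * (H xt - H u) + tau3 * (H y - H u) + tau1 * dot e (u - z)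
     + tau1 * k * dot (u - z) (u - z) + (4 * L)^-1 * dot e e].
Proof.
move=> L0 t10 t20 t12 xtD yD uD tau3 k x z' y' e.
have k0 : 0 < k by rewrite /k divr_gt0// !mulr_gt0.
have L30 : 0 < 3 * L / 2 by lra.
have Lmu0 : 0 <= 3 * L / 2 + mu / 2 by move: mu_ge0; lra.
have [z'D Hz] := argmin_proxP h_pcc h_strong g z k0.
have [y'D Hy] := argmin_proxP h_pcc h_strong g x L30.
rewrite -/z' in z'D Hz; rewrite -/y' in y'D Hy.
clearbody z' y'.
split=> //.
pose v := tau1 *: z' + tau2 *: xt + tau3 *: y.
have t30 : 0 <= tau3 by rewrite /tau3; lra.
(* The three-point combination is built from two binary ones: z' with xt, then the result with y. *)
have [vD Hv] : dom h v /\
    fine (h v) <= tau1 * fine (h z') + tau2 * fine (h xt) + tau3 * fine (h y).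
  have [t31|t3_neq1] := eqVneq tau3 1.
    by move: t31; rewrite /tau3; lra.
  have s0 : 0 < tau1 + tau2 by lra.
  have a01 : 0 <= tau1 / (tau1 + tau2) <= 1.
    by rewrite ler_pdivrMr// mul1r lerDl t20 divr_ge0 ?ltW.
  have b01 : 0 <= tau1 + tau2 <= 1 by rewrite ltW.
  have [cD Hc] := dom_conv h_pcc z'D xtD a01.
  have aC : 1 - tau1 / (tau1 + tau2) = tau2 / (tau1 + tau2) by field; rewrite gt_eqF.
  have [] := dom_conv h_pcc cD yD b01.
  have -> : (tau1 + tau2) *: (tau1 / (tau1 + tau2) *: z' +
      (1 - tau1 / (tau1 + tau2)) *: xt) + (1 - (tau1 + tau2)) *: y = v.
    rewrite aC scalerDr !scalerA !(mulrCA (tau1 + tau2)) mulfV ?gt_eqF// !mulr1.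
    by rewrite /v /tau3 opprD addrA.
  move=> vD Hv; split=> //; apply: (le_trans Hv).
  rewrite /tau3 opprD addrA lerD2r.
  move: Hc; rewrite -(ler_pM2l s0) => /le_trans; apply.
  by rewrite aC le_eqVlt; apply/orP; left; apply/eqP; field; rewrite gt_eqF.
have {}Hy := Hy v vD; have {}Hz := Hz u uD.
have vx : v - x = tau1 *: (z' - z).
  by apply/rowP => i; rewrite /v /x !mxE; ring.
have vE : v = x + tau1 *: (z' - z) by rewrite -vx subrKC.
rewrite vx [in dot g v]vE in Hy.
have D1 := descent_lemma x y' f_smooth.
have C1 := convex_grad_ineq x u f_convex f_smooth.
have C2 := convex_grad_ineq x xt f_convex f_smooth.
have C3 := convex_grad_ineq x y f_convex f_smooth.
(* Of the curvature 3 L / 2 in the step for y', the descent lemma uses L / 2; the remaining L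
   absorbs the error. *)
have E1 : - dot e (y' - x) <= L * dot (y' - x) (y' - x) + (4 * L)^-1 * dot e e.
  have := @young_dot _ _ (y' - x) (- e) (2 * L).
  have L2 : 2 * L / 2 = L by field.
  have L4 : 2 * (2 * L) = 4 * L by ring.
  by rewrite dotNr dotNl dotNr opprK (dotC _ e) L2 L4 mulr_gt0// => /(_ isT).
have gE : g = grad f x + e by rewrite /e subrKC.
set p := z' - z in vE Hy Hz; set q := y' - x in Hy D1 E1.
have gy : dot g y' = dot g x + dot g q by rewrite -dotDr subrKC.
have gz : dot g z' = dot g z + dot g p by rewrite -dotDr subrKC.
have gu : dot g u = dot g z + dot g (u - z) by rewrite -dotDr subrKC.
have gq : dot g q = dot (grad f x) q + dot e q by rewrite -dotDl -gE.
have guz : dot g (u - z) = dot (grad f x) (u - z) + dot e (u - z).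
  by rewrite -dotDl -gE.
(* The definition of x rewrites the slope along u - z through slopes from x towards u, xt and y,
   where convexity of f applies. *)
have duz : tau1 * dot (grad f x) (u - z) = tau1 * dot (grad f x) (u - x) +
    tau2 * dot (grad f x) (xt - x) + tau3 * dot (grad f x) (y - x).
  rewrite -!dotZr -!dotDr; congr (dot _ _).
  by apply/rowP => i; rewrite /x /tau3 !mxE; ring.
have gv : dot g (x + tau1 *: p) = dot g x + tau1 * dot g p.
  by rewrite dotDr dotZr.
have pp : dot (tau1 *: p) (tau1 *: p) = tau1 * (tau1 * dot p p).
  by rewrite dotZr dotZl.
have vy0 := mulr_ge0 Lmu0 (dot_ge0 (v - y')).
move/(ler_wpM2l (ltW t10)) : Hz => Hz.
move/(ler_wpM2l (ltW t10)) : C1 => C1.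
move/(ler_wpM2l t20) : C2 => C2.
move/(ler_wpM2l t30) : C3 => C3.
rewrite gy gq gv pp in Hy; rewrite gz gu guz in Hz.
move: Hy Hz Hv D1 C1 C2 C3 E1 vy0 duz; rewrite /H /k /tau3.
move: (dot g x) (dot g z) (dot g p) (dot e q) (dot (grad f x) q) (dot q q) (dot p p)
  (dot (v - y') (v - y')) (dot (u - z') (u - z')) (dot (u - z) (u - z))
  (dot (grad f x) (u - z)) (dot e (u - z)) (dot (grad f x) (u - x))
  (dot (grad f x) (xt - x)) (dot (grad f x) (y - x)) (dot e e)
  (fine (h y')) (fine (h z')) (fine (h v)) (fine (h xt)) (fine (h y)) (fine (h u))
  (f y') (f x) (f u) (f xt) (f y) (4 * L)^-1.
by clear => *; lra.
Qed.

End CompositeStep.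

(** * Convergence *)

Section StepSizes.
Context {R : realType}.

Lemma pos_ceil_gt0 (x : R) : (0 < pos_ceil x)%N.
Proof. by rewrite /pos_ceil leq_max. Qed.

Lemma le_pos_ceil (x : R) : x <= (pos_ceil x)%:R.
Proof.
have [x0|/ltW x0] := leP 0 x; last exact: le_trans x0 (ler0n _ _).
apply: (le_trans (ceil_ge x)); rewrite /pos_ceil.
have c0 : 0 <= Num.ceil x by rewrite -(ler_int R) (le_trans x0)// ceil_ge.
rewrite -[Num.ceil x]gez0_abs// -pmulrn ler_nat /= leq_max.
by rewrite leqnn orbT.
Qed.

Lemma batch_size_le (a b mu : R) : 0 < mu -> 0 < b ->
  a / (pos_ceil (b * a / mu ^+ 2))%:R <= mu ^+ 2 / b.
Proof.
move=> mu0 b0; have c0 : 0 < (pos_ceil (b * a / mu ^+ 2))%:R :> R.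
  by rewrite ltr0n pos_ceil_gt0.
have := le_pos_ceil (b * a / mu ^+ 2).
rewrite ler_pdivrMr ?exprn_gt0// => H.
by rewrite ler_pdivrMr// mulrAC ler_pdivlMr// mulrC (mulrC (mu ^+ 2)).
Qed.

(** With s = sqrt (L / mu), both bounds say s / 2 <= m <= s. The upper one survives rounding up
    because s >= 1 settles m = 1, and for m >= 2 one has s > 2 (m - 1) >= m. *)
Lemma inner_length_bounds (L mu : R) (m : nat) : 0 < mu -> mu <= L ->
  m = `|Num.ceil (1 / 2 * Num.sqrt (L / mu))|%N ->
  [/\ (0 < m)%N, L <= 4 * m%:R ^+ 2 * mu & mu * m%:R ^+ 2 <= L].
Proof.
move=> mu0 muL; set s := Num.sqrt _ => mE.
have s2 : s ^+ 2 = L / mu by rewrite sqr_sqrtr// divr_ge0//; lra.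
have s1 : 1 <= s.
  by rewrite -[1]sqrtr1 ler_wsqrtr// ler_pdivlMr// mul1r.
have c0 : 0 < Num.ceil (1 / 2 * s) by rewrite ceil_gt0; lra.
have mR : m%:R = (Num.ceil (1 / 2 * s))%:~R :> R.
  by rewrite mE pmulrn gez0_abs// ltW.
have m0 : (0 < m)%N by rewrite mE absz_gt0 gt_eqF.
have m_ge : s <= 2 * m%:R.
  by rewrite mR; have := ceil_ge (1 / 2 * s); lra.
have m_le : m%:R <= s.
  have [m1|m2] := leqP m 1; first by apply: le_trans s1; rewrite lern1.
  have : (2 : R) <= m%:R by rewrite ler_nat.
  by have := ceilB1_lt (1 / 2 * s); rewrite intrB -mR; lra.
have LE : L = s ^+ 2 * mu by rewrite s2 mulfVK// gt_eqF.
split=> //.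
  rewrite [L in L <= _]LE ler_pM2r// (_ : 4 * _ = (2 * m%:R) ^+ 2); last by ring.
  by rewrite ler_sqr// nnegrE; lra.
rewrite [leRHS]LE mulrC ler_pM2r// ler_sqr ?nnegrE//; lra.
Qed.

Lemma bernoulli_le (x : R) n : 0 <= x -> 1 + n%:R * x <= (1 + x) ^+ n.
Proof.
move=> x0; elim: n => [|n IH]; first by rewrite mul0r addr0 expr0.
rewrite exprS; apply: (@le_trans _ _ ((1 + x) * (1 + n%:R * x))).
  have := mulr_ge0 (mulr_ge0 (ler0n R n) x0) x0.
  by rewrite -natr1; lra.
by rewrite ler_wpM2l// addr_ge0.
Qed.

End StepSizes.

Section Convergence.
Context {R : realType} {N1 N2 n1 n2 : nat}.
Variables (F : 'I_n1 -> 'rV[R]_N1 -> R) (G : 'I_n2 -> 'rV[R]_N2 -> 'rV[R]_N1).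
Variables (h : 'rV[R]_N2 -> \bar R) (mu L LF BF LG BG : R).
Hypotheses (n1_gt0 : (0 < n1)%N) (n2_gt0 : (0 < n2)%N).
Hypothesis f_convex : convex_function [set: convex_lmodType 'rV[R]_N2] (objf F G).
Hypothesis h_pcc : proper_closed_convex h.
Hypotheses (mu_gt0 : 0 < mu) (h_strong : strongly_convex mu h).
Hypothesis F_smooth : forall i, smooth_fun LF (F i).
Hypothesis F_bounded : forall i, bounded_grad BF (F i).
Hypothesis G_smooth : forall j, smooth_map LG (G j).
Hypothesis G_bounded : forall j, bounded_jac BG (G j).
Hypothesis FG_lip : forall i j x y,
  enorm (grad (F i) (meanG G x) *m jac (G j) x
         - grad (F i) (meanG G y) *m jac (G j) y) <= L * enorm (x - y).
Variable u : 'rV[R]_N2.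
Hypothesis u_min : minimizer (objH F G h) u.
Variables (m A B C : nat).
Hypotheses (A_gt0 : (0 < A)%N) (B_gt0 : (0 < B)%N) (C_gt0 : (0 < C)%N).
Hypothesis A_ge : BG ^+ 4 * LF ^+ 2 / A%:R <= mu ^+ 2 / 2160.
Hypothesis B_ge : (BF * LG) ^+ 2 / B%:R <= mu ^+ 2 / 2160.
Hypothesis C_ge : L ^+ 2 / C%:R <= mu ^+ 2 / 1080.
Hypothesis m_gt0 : (0 < m)%N.
Hypothesis L_le : L <= 4 * m%:R ^+ 2 * mu.
Hypothesis L_ge : mu * m%:R ^+ 2 <= L.
Variables (tau theta alpha : R).
Hypothesis tauE : tau = 1 / (2 * m%:R).
Hypothesis thetaE : theta = 1 + 1 / (12 * m%:R).
Hypothesis alphaE : alpha = 1 / (3 * tau * L).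

Local Notation H := (composite (objf F G) h).
Local Notation dr := (@draw n1 n2 A B C).
Local Notation gap w := (H w - H u).

Let M := m%:R : R.
Let tau3 : R := 1 - tau - tau.
Let k : R := 3 * tau * L / 2.
(** The error term 7/4 (tau / mu) |e|^2 averages to at most (7/720) tau mu |x - xt|^2. Its gap part,
    times 4 / mu, is the 7 tau / 180 added in [cT] and [kap]. In [K], 21/100 is 1/5 from Young's
    inequality plus 1/100, which covers 7/720 times 2 tau <= 1. *)
Let cT : R := tau * (187 / 180).
Let kap : R := tau3 * (1 + 7 * tau / 180).
Let K : R := tau * (k + 21 * mu / 100).

Let M_ge1 : 1 <= M. Proof. by rewrite ler1n. Qed.
Let M_gt0 : 0 < M. Proof. by apply: lt_le_trans M_ge1. Qed.
Let tauM : tau * M = 1 / 2. Proof. by rewrite tauE -/M; field; rewrite gt_eqF. Qed.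
Let tau_gt0 : 0 < tau. Proof. by rewrite tauE -/M divr_gt0// mulr_gt0. Qed.
Let tau_le : tau <= 1 / 2.
Proof. by have := ler_wpM2l (ltW tau_gt0) M_ge1; rewrite tauM mulr1. Qed.
Let tau3_ge0 : 0 <= tau3. Proof. by rewrite /tau3; have := tau_le; lra. Qed.
Let L_gt0 : 0 < L.
Proof. by apply: lt_le_trans L_ge; rewrite mulr_gt0// exprn_gt0. Qed.
Let theta_tau : theta = 1 + tau / 6.
Proof. by rewrite thetaE tauE -/M; field; rewrite gt_eqF. Qed.
(** This bound and the next place tau between sqrt (mu / L) / 2 and sqrt (mu / L), the scale of an
    accelerated method. *)
Let tauL_le : tau * tau * L <= mu.
Proof.
rewrite (_ : mu = tau * tau * (4 * M ^+ 2 * mu)).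
  by rewrite ler_pM2l ?mulr_gt0.
rewrite (_ : _ * _ = 4 * (tau * M) ^+ 2 * mu); last by ring.
by rewrite tauM; field.
Qed.
Let mu_le_tauL : mu <= 4 * (tau * tau * L).
Proof.
rewrite (_ : mu = 4 * (tau * tau * (mu * M ^+ 2))).
  by rewrite ler_pM2l// ler_pM2l ?mulr_gt0.
rewrite (_ : 4 * _ = 4 * (tau * M) ^+ 2 * mu); last by ring.
by rewrite tauM; field.
Qed.
Let k_gt0 : 0 < k. Proof. by rewrite /k divr_gt0// !mulr_gt0. Qed.
Let K_ge0 : 0 <= K.
Proof. by rewrite mulr_ge0// ?ltW//; have := k_gt0; have := mu_gt0; lra. Qed.
Let kap_ge0 : 0 <= kap.
Proof. by rewrite mulr_ge0//; have := tau_gt0; lra. Qed.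
Let theta_gt0 : 0 < theta. Proof. by rewrite theta_tau; have := tau_gt0; lra. Qed.

Let f_smooth : smooth_fun L (objf F G).
Proof. exact: objf_smooth. Qed.

Let uD : dom h u. Proof. exact: (minimizer_dom h_pcc u_min). Qed.

Lemma gap_growth w : dom h w -> mu / 2 * dot (u - w) (u - w) <= gap w.
Proof. exact: (composite_growth f_convex f_smooth h_pcc h_strong u_min). Qed.

Lemma gap_ge0 w : dom h w -> 0 <= gap w.
Proof.
by move=> /gap_growth; apply: le_trans; rewrite mulr_ge0 ?dot_ge0// divr_ge0// ltW.
Qed.

(** The weight tau that x puts on xt contributes nothing to x - xt, and the other two distances are
    split through u. The distance from u to z is kept, as no gap at z is tracked. *)
Lemma snapshot_dist_le xt y z x : dom h xt -> dom h y ->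
  x = tau *: z + tau *: xt + tau3 *: y ->
  dot (x - xt) (x - xt) <=
  2 * tau * dot (u - z) (u - z) + 4 / mu * (gap xt + tau3 * gap y).
Proof.
move=> xtD yD ->.
have -> : tau *: z + tau *: xt + tau3 *: y - xt = tau *: (z - xt) + tau3 *: (y - xt).
  by apply/rowP => i; rewrite /tau3 !mxE; ring.
have := @dot_sqr_conv2_le _ _ (z - xt) (y - xt) tau tau3.
rewrite ltW// tau3_ge0 => /(_ isT isT).
have -> : tau + tau3 <= 1 by rewrite /tau3; have := tau_gt0; lra.
move=> /(_ isT) /le_trans; apply.
have split v : dot (v - xt) (v - xt) <= 2 * dot (u - v) (u - v) + 2 * dot (u - xt) (u - xt).
  have := dot_sqrD_le (- (u - v)) (u - xt).
  by rewrite dotNl dotNr opprK opprB addrA subrK.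
have zs := ler_wpM2l (ltW tau_gt0) (split z).
have ys := ler_wpM2l tau3_ge0 (split y).
have g0 : 0 <= 4 / mu by rewrite divr_ge0// ltW.
have gx := ler_wpM2l g0 (gap_growth xtD).
have gy := ler_wpM2l tau3_ge0 (ler_wpM2l g0 (gap_growth yD)).
have muE w : 4 / mu * (mu / 2 * w) = 2 * w by field; rewrite gt_eqF.
rewrite !muE in gx gy.
have d0 := mulr_ge0 (ltW tau_gt0) (dot_ge0 (u - xt)).
move: zs ys gx gy d0; rewrite /tau3; lra.
Qed.

Local Notation step := (inner_step F G h L alpha tau tau).

Lemma inner_step_le xt y z (d : dr) : dom h xt -> dom h y ->
  let x := tau *: z + tau *: xt + tau3 *: y in
  let e := est_grad F G d xt x - grad (objf F G) x in
  let p := step xt (y, z) d in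
  dom h p.1 /\
  gap p.1 + theta * K * dot (u - p.2) (u - p.2) <=
  tau * gap xt + tau3 * gap y + tau * (k + mu / 5) * dot (u - z) (u - z)
  + 7 / 4 * (tau / mu) * dot e e.
Proof.
move=> xtD yD x e p.
have aE : (2 * alpha)^-1 = 3 * tau * L / 2.
  by rewrite alphaE; field; rewrite !gt_eqF.
have tt1 : tau + tau <= 1 by have := tau_le; lra.
have := accelerated_step f_convex f_smooth h_pcc (ltW mu_gt0) h_strong
  (est_grad F G d xt x) z L_gt0 tau_gt0 (ltW tau_gt0) tt1 xtD yD uD.
rewrite -aE -/tau3 -/x => -[y'D _ Hstep].
split; first exact: y'D.
move: Hstep; rewrite -/e -[argmin _]/(p.1) -[argmin (fun w => _ + _)%E]/(p.2).
move: (p.1) (p.2) => y' z'; rewrite aE -/k.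
(* This parameter costs mu / 5 on |u - z|^2 and 5 / (4 mu) on |e|^2; the bound [iL] below adds 1 /
   (2 mu), whence 7 / 4. *)
have c5 : 0 < 2 * mu / 5 by have := mu_gt0; lra.
have := young_dot (u - z) e c5; rewrite dotC.
have -> : 2 * mu / 5 / 2 = mu / 5 by field.
have -> : (2 * (2 * mu / 5))^-1 = 5 / 4 / mu by field; rewrite gt_eqF.
move/(ler_wpM2l (ltW tau_gt0)).
have iL : (4 * L)^-1 <= tau / mu / 2.
  rewrite -[_^-1]mul1r ler_pdivrMr ?mulr_gt0//.
  rewrite [leRHS](_ : _ = 2 * tau * L / mu); last by field; rewrite gt_eqF.
  rewrite ler_pdivlMr// mul1r; apply: (le_trans mu_le_tauL).
  have := ler_wpM2l (ltW (mulr_gt0 tau_gt0 L_gt0)) tau_le; lra.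
(* Per unit of tau, the factor theta costs tau k / 6 = tau^2 L / 4 <= mu / 4 plus less than mu / 50;
   with 21 mu / 100 this stays below mu / 2. *)
have tK : theta * K <= tau * (k + mu / 2).
  rewrite /K mulrCA ler_pM2l// theta_tau /k.
  have := tauL_le; have := ler_wpM2l (ltW mu_gt0) tau_le; have := mu_gt0; lra.
move: (ler_wpM2r (dot_ge0 e) iL) (ler_wpM2r (dot_ge0 (u - z')) tK).
move: (gap y') (gap xt) (gap y) (dot e (u - z)) (dot e e)
  (dot (u - z) _) (dot (u - z') _) (theta * K) (tau3) k (mu^-1) (4 * L)^-1.
move=> *; lra.
Qed.

Lemma umean_inner_step xt y z : dom h xt -> dom h y ->
  umean (fun d : dr => let p := step xt (y, z) d in
    gap p.1 + theta * (K * dot (u - p.2) (u - p.2))) <=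
  cT * gap xt + kap * gap y + K * dot (u - z) (u - z).
Proof.
move=> xtD yD.
pose x := tau *: z + tau *: xt + tau3 *: y.
have dist := snapshot_dist_le xtD yD (erefl : x = tau *: z + tau *: xt + tau3 *: y).
set Q := tau * gap xt + tau3 * gap y + tau * (k + mu / 5) * dot (u - z) (u - z).
apply: (@le_trans _ _ (umean (fun d : dr => Q + 7 / 4 * (tau / mu) *
    (let e := est_grad F G d xt x - grad (objf F G) x in dot e e)))).
  by apply: le_umean => d /=; rewrite mulrA; have [] := inner_step_le z d xtD yD.
have cT0 := card_draw_gt0 n1_gt0 n2_gt0 A B C.
rewrite umeanD umeanZ umean_cst//.
have c0 : 0 <= 7 / 4 * (tau / mu) by rewrite mulr_ge0 ?divr_ge0// ltW.
have := ler_wpM2l c0 (est_grad_error n1_gt0 n2_gt0 F_smooth F_bounded G_smooth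
  G_bounded FG_lip xt x A_gt0 B_gt0 C_gt0).
set SB := _ / B%:R + _ + _.
move: (umean _) => E HE.
(* 1/2160 + 1/2160 + 1/1080 = 1/540; the factor 3 from splitting the error then gives mu^2 / 180. *)
have b0 : SB <= mu ^+ 2 / 540 by move: A_ge B_ge C_ge; rewrite /SB; lra.
have c1 : 0 <= 3 * (7 / 4 * (tau / mu)) by exact: mulr_ge0.
have := ler_wpM2l c1 (ler_wpM2r (dot_ge0 (x - xt)) b0).
rewrite (_ : _ * (mu ^+ 2 / 540 * _) =
  7 / 720 * (tau * mu) * dot (x - xt) (x - xt)); last first.
  by field; rewrite gt_eqF.
have c2 : 0 <= 7 / 720 * (tau * mu).
  by have := mulr_ge0 (ltW tau_gt0) (ltW mu_gt0); lra.
have := ler_wpM2l c2 dist.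
rewrite mulrDr (_ : 7 / 720 * (tau * mu) * (4 / mu * _) =
  7 / 180 * tau * (gap xt + tau3 * gap y)); last by field; rewrite gt_eqF.
have := ler_wpM2r (mulr_ge0 (mulr_ge0 (ltW tau_gt0) (ltW mu_gt0)) (dot_ge0 (u - z))) tau_le.
have := mulr_ge0 (mulr_ge0 (ltW tau_gt0) (ltW mu_gt0)) (dot_ge0 (u - z)).
move: HE; rewrite /Q /cT /kap /K.
move: SB {b0 dist Q c0 c1 c2} (dot (x - xt) (x - xt)) (dot (u - z) (u - z)) (gap xt) (gap y)
  (tau3) k (mu^-1).
by move=> *; lra.
Qed.

(** * Inner and outer loops *)

Lemma scanl_dom xt (ds : seq dr) p p0 : dom h xt -> dom h p.1 ->
  (forall j, (j < size ds)%N -> dom h (nth p0 (scanl (step xt) p ds) j).1) /\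
  dom h (last p (scanl (step xt) p ds)).1.
Proof.
move=> xtD; elim: ds p => [|d ds IH] [y z] yD //.
have [y'D _] := inner_step_le z d xtD yD.
have [I1 I2] := IH _ y'D.
by split=> // -[|j] //; exact: I1.
Qed.

(** Under weights theta^j the distance terms telescope exactly. The gap at y reappears one index
    later with factor [kap * theta], leaving 1 - [kap * theta] of each gap and one boundary term.
    Entry j of [scanl] is already iterate j + 1. *)
Lemma inner_loop_le n xt p p0 : dom h xt -> dom h p.1 ->
  umean (fun ds : n.-tuple dr => let its := scanl (step xt) p ds in
    (1 - kap * theta) * (\sum_(j < n) theta ^+ j * gap (nth p0 its j).1) +
    theta ^+ n * (kap * gap (last p its).1
                  + K * dot (u - (last p its).2) (u - (last p its).2))) <=
  cT * gap xt * (\sum_(j < n) theta ^+ j) + kap * gap p.1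
  + K * dot (u - p.2) (u - p.2).
Proof.
move=> xtD; elim: n p => [|n IH] [y z] yD.
  by rewrite umean_tuple0 /= !big_ord0 !mulr0 !add0r expr0 mul1r lexx.
rewrite umean_tupleS.
apply: (@le_trans _ _ (umean (fun d : dr => let q := step xt (y, z) d in
    (gap q.1 + theta * (K * dot (u - q.2) (u - q.2))) +
    theta * (cT * gap xt * (\sum_(j < n) theta ^+ j))))).
  apply: le_umean => d; set q := step _ _ _.
  have [qD _] := inner_step_le z d xtD yD.
  have cdr : (0 < #|{: n.-tuple dr}|)%N.
    by rewrite card_tuple expn_gt0 card_draw_gt0.
  apply: (@le_trans _ _ ((1 - kap * theta) * gap q.1 + theta *
     umean (fun ds : n.-tuple dr => let its := scanl (step xt) q ds in
    (1 - kap * theta) * (\sum_(j < n) theta ^+ j * gap (nth p0 its j).1) +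
    theta ^+ n * (kap * gap (last q its).1
                  + K * dot (u - (last q its).2) (u - (last q its).2))))).
    rewrite -umeanZ -[X in _ <= X + _](umean_cst _ cdr) -umeanD.
    apply: le_umean => ds /=; rewrite -/q big_ord_recl /= expr0 mul1r exprS.
    under eq_bigr do rewrite /bump /= add1n exprS -mulrA.
    rewrite -mulr_sumr; move: (\sum_(j < n) _) (gap _) (gap _) (dot _ _) (theta ^+ n).
    by move=> *; lra.
  have := ler_wpM2l (ltW theta_gt0) (IH q qD); rewrite /=.
  move: (umean _) (gap q.1) (gap xt) (dot _ _) (\sum_(j < n) _) => a1 a2 a3 a4 a5.
  by move=> *; lra.
rewrite umeanD umean_cst ?card_draw_gt0//.
have := umean_inner_step z xtD yD.
rewrite big_ord_recl expr0 /=.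
have -> : \sum_(i < n) theta ^+ bump 0 i = theta * \sum_(i < n) theta ^+ i.
  by rewrite mulr_sumr; apply: eq_bigr => i _; rewrite /bump add1n exprS.
move: (umean _) (gap y) (gap xt) (dot _ _) (\sum_(j < n) _) => a1 a2 a3 a4 a5.
by move=> *; lra.
Qed.

Let Th := \sum_(j < m) theta ^+ j.

Let Phi (st : 'rV[R]_N2 * 'rV[R]_N2 * 'rV[R]_N2) : R :=
  cT * gap st.1.1 * Th + kap * gap st.1.2 + K * dot (u - st.2) (u - st.2).

Local Notation outer := (@outer_step R N1 N2 n1 n2 F G h L theta alpha tau tau m A B C).

Let Th_ge : M <= Th.
Proof.
rewrite /Th -[M]/(m%:R) -[m in m%:R]card_ord -sum1_card natr_sum.
apply: ler_sum => j _; apply: exprn_ege1.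
by rewrite theta_tau; have := tau_gt0; lra.
Qed.

(** Bernoulli's inequality with m tau / 6 = 1 / 12. *)
Let rate_theta : 13 / 12 <= theta ^+ m.
Proof.
have t6 : 0 <= tau / 6 by have := tau_gt0; lra.
have := bernoulli_le m t6; rewrite -theta_tau; apply: le_trans.
by have := tauM; rewrite /M; lra.
Qed.

(** The 2 tau inside [tau3] dominates: the right side is at least 1.79 tau, the left side below 1.13
    tau. *)
Let rate_snapshot : 13 / 12 * cT <= 1 - kap * theta.
Proof.
rewrite /cT /kap /tau3 theta_tau.
have t2 := ler_wpM2l (ltW tau_gt0) tau_le.
have t0 := mulr_ge0 (ltW tau_gt0) (ltW tau_gt0).
have t3 := mulr_ge0 t0 (ltW tau_gt0).
by have := tau_gt0; move: t2 t0 t3; lra.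
Qed.

Lemma outer_stepE xt y z (ds : m.-tuple dr) : outer (xt, y, z) ds =
  (Th^-1 *: \sum_(j < m) theta ^+ j *: (nth (y, z) (scanl (step xt) (y, z) ds) j).1,
   (last (y, z) (scanl (step xt) (y, z) ds)).1,
   (last (y, z) (scanl (step xt) (y, z) ds)).2).
Proof. by rewrite /outer_step; case: (last _ _). Qed.

Lemma outer_step_le st : dom h st.1.1 -> dom h st.1.2 ->
  (forall ds : m.-tuple dr, dom h (outer st ds).1.1 /\ dom h (outer st ds).1.2) /\
  umean (fun ds : m.-tuple dr => Phi (outer st ds)) <= 12 / 13 * Phi st.
Proof.
case: st => [[xt y] z] xtD yD.
have its_dom ds := @scanl_dom xt (tval ds) (y, z) (y, z) xtD yD.
have jensen (ds : m.-tuple dr) := composite_jensen f_convex h_pcc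
  (y := fun j => (nth (y, z) (scanl (step xt) (y, z) ds) j).1)
  m_gt0 (fun j => @exprn_gt0 R j theta theta_gt0).
have jensenD (ds : m.-tuple dr) := jensen ds (fun j jm =>
  proj1 (its_dom m ds) j (eq_ind_r (fun k => (j < k)%N) jm (size_tuple ds))).
split=> [ds|].
  rewrite outer_stepE; have [_ ? _] := jensenD ds.
  by split=> //; have [] := its_dom m ds.
have := inner_loop_le m (y, z) xtD (yD : dom h (y, z).1).
rewrite -/Th => H; rewrite -(@ler_pM2l _ (13 / 12)); last by lra.
rewrite -umeanZ mulrA (_ : 13 / 12 * (12 / 13) = 1) ?mul1r; last by field.
apply: le_trans H; apply: le_umean => ds.
rewrite outer_stepE /Phi /=.
have [Th0 vD Hv] := jensenD ds; have [_ lD] := its_dom m ds.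
rewrite -/Th in Th0 vD Hv.
set its := scanl _ _ _ in vD Hv lD *; set v := Th^-1 *: _ in vD Hv *.
have {}Hv : Th * gap v <= \sum_(j < m) theta ^+ j * gap (nth (y, z) its j).1.
  under [leRHS]eq_bigr do rewrite mulrBr.
  by rewrite sumrB -mulr_suml -/Th mulrBr lerD2r.
have g0 := gap_ge0 vD.
have q0 := gap_ge0 lD.
have r1 := ler_wpM2r (mulr_ge0 (ltW Th0) g0) rate_snapshot.
have s0 : 0 <= 1 - kap * theta.
  by apply: le_trans rate_snapshot; rewrite /cT; have := tau_gt0; lra.
have r2 := ler_wpM2l s0 Hv.
have r3 := ler_wpM2r (addr_ge0 (mulr_ge0 kap_ge0 q0) (mulr_ge0 K_ge0
  (dot_ge0 (u - (last (y, z) its).2)))) rate_theta.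
move: r1 r2 r3; clearbody v.
move: (gap v) (gap _) (dot _ _) (theta ^+ m) (\sum_(j < m) _ * _) cT kap K Th.
by move=> a1 a2 a3 a4 a5 a6 a7 a8 a9 r1 r2 r3; lra.
Qed.

Lemma foldl_outer_le S st : dom h st.1.1 -> dom h st.1.2 ->
  (forall w : S.-tuple (m.-tuple dr), dom h (foldl outer st w).1.1 /\
     dom h (foldl outer st w).1.2) /\
  umean (fun w : S.-tuple (m.-tuple dr) => Phi (foldl outer st w))
  <= (12 / 13) ^+ S * Phi st.
Proof.
elim: S st => [|S IH] st xtD yD.
  split=> [w|]; first by rewrite tuple0.
  by rewrite umean_tuple0 expr0 mul1r.
have [oD o_le] := outer_step_le xtD yD; split=> [w|].
  rewrite (tuple_eta w) /=; have [D1 D2] := oD (thead w).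
  by have [] := IH _ D1 D2 => /(_ [tuple of behead w]).
rewrite umean_tupleS.
apply: (@le_trans _ _ (umean (fun ds => (12 / 13) ^+ S * Phi (outer st ds)))).
  apply: le_umean => ds; have [D1 D2] := oD ds.
  exact: (proj2 (IH _ D1 D2)).
rewrite umeanZ exprSr -mulrA ler_wpM2l// exprn_ge0//.
Qed.

Lemma SoCK_dom S x0 (w : S.-tuple (m.-tuple dr)) : dom h x0 ->
  dom h (SoCK F G h L theta alpha tau tau x0 w).
Proof.
by move=> x0D; have [] := foldl_outer_le S (st := (x0, x0, x0)) x0D x0D => /(_ w)[].
Qed.

(** Origin of 11: initially [Phi] is at most [cT * Th] + 21/20 + 321/100 times the gap, and 4.26 <=
    10 [cT * Th] because [cT * Th] >= 187/360. *)
Lemma gap_SoCK_le S x0 : dom h x0 ->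
  umean (fun w : S.-tuple (m.-tuple dr) =>
    gap (SoCK F G h L theta alpha tau tau x0 w)) <=
  11 * (12 / 13) ^+ S * gap x0.
Proof.
move=> x0D; have [wD] := foldl_outer_le S (st := (x0, x0, x0)) x0D x0D.
have cT0 : 0 < cT by rewrite /cT; have := tau_gt0; lra.
have Th0 : 0 < Th by exact: lt_le_trans M_gt0 Th_ge.
have cTh0 : 0 < cT * Th by exact: mulr_gt0.
have cTh : 187 / 360 <= cT * Th.
  apply: (@le_trans _ _ (cT * M)); last by rewrite ler_pM2l.
  by rewrite /cT; have := tauM; lra.
have PhiS : cT * Th * umean (fun w : S.-tuple (m.-tuple dr) =>
    gap (SoCK F G h L theta alpha tau tau x0 w)) <=
    umean (fun w : S.-tuple (m.-tuple dr) => Phi (foldl outer (x0, x0, x0) w)).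
  rewrite -umeanZ; apply: le_umean => w; have [D1 D2] := wD w.
  rewrite /Phi /SoCK; move: (foldl _ _ _) D2 => st D2.
  have q0 := mulr_ge0 kap_ge0 (gap_ge0 D2).
  have q1 := mulr_ge0 K_ge0 (dot_ge0 (u - st.2)).
  apply: (@le_trans _ _ (cT * gap st.1.1 * Th)); first by rewrite mulrAC.
  by rewrite -[leRHS]addrA lerDl addr_ge0.
move=> /(le_trans PhiS) H; rewrite -(ler_pM2l cTh0); apply: (le_trans H).
rewrite [leRHS](_ : _ = (12 / 13) ^+ S * (cT * Th * (11 * gap x0))); last first.
  by move: (_ ^+ S) => r; ring.
apply: ler_wpM2l; first by rewrite exprn_ge0//; exact: divr_ge0.
have g0 := gap_ge0 x0D.
have kg : K * dot (u - x0) (u - x0) <= 321 / 100 * gap x0.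
  have Kmu : K <= 321 / 100 * (mu / 2).
    rewrite /K /k; have := tauL_le; have := ler_wpM2r (ltW mu_gt0) tau_le.
    by have := mu_gt0; lra.
  apply: (le_trans (ler_wpM2r (dot_ge0 _) Kmu)).
  by have := gap_growth x0D; lra.
have kap_le : kap <= 21 / 20.
  rewrite /kap /tau3; have := tau_le; have := mulr_ge0 (ltW tau_gt0) (ltW tau_gt0).
  by have := tau_gt0; lra.
have k1 := ler_wpM2r g0 kap_le.
have k2 := ler_wpM2r g0 cTh.
rewrite /Phi /=; move: kg k1 k2 g0.
move: (gap x0) (dot _ _) cT kap K Th => a1 a2 a3 a4 a5 a6 k0 k1 k2 g0; lra.
Qed.

End Convergence.

Theorem theorem5p3 (R : realType) (N1 N2 n1 n2 : nat)
    (n1_gt0 : (0 < n1)%N) (n2_gt0 : (0 < n2)%N)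
    (F : 'I_n1 -> 'rV[R]_N1 -> R) (G : 'I_n2 -> 'rV[R]_N2 -> 'rV[R]_N1)
    (h : 'rV[R]_N2 -> \bar R) (mu L LF BF LG BG : R)
    (f_convex : convex_function [set: convex_lmodType 'rV[R]_N2] (objf F G))
    (h_pcc : proper_closed_convex h)
    (mu_gt0 : 0 < mu) (h_strong : strongly_convex mu h)
    (F_smooth : forall i, smooth_fun LF (F i))
    (F_bounded : forall i, bounded_grad BF (F i))
    (G_smooth : forall j, smooth_map LG (G j))
    (G_bounded : forall j, bounded_jac BG (G j))
    (FG_lip : forall i j x y,
       enorm (grad (F i) (meanG G x) *m jac (G j) x
              - grad (F i) (meanG G y) *m jac (G j) y) <= L * enorm (x - y))
    (mu_le_L : mu <= L)
    (xstar : 'rV[R]_N2) (xstar_min : minimizer (objH F G h) xstar)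
    (x0 : 'rV[R]_N2) (x0_dom : (h x0 < +oo)%E)
    (m A B C : nat) (tau1 tau2 theta alpha : R)
    (m_def : m = `|Num.ceil (1 / 2 * Num.sqrt (L / mu))|%N)
    (tau1_def : tau1 = 1 / (2 * m%:R)) (tau2_def : tau2 = 1 / (2 * m%:R))
    (theta_def : theta = 1 + 1 / (12 * m%:R))
    (alpha_def : alpha = 1 / (3 * tau1 * L))
    (A_def : A = pos_ceil (2160 * BG ^+ 4 * LF ^+ 2 / mu ^+ 2))
    (B_def : B = pos_ceil (2160 * BF ^+ 2 * LG ^+ 2 / mu ^+ 2))
    (C_def : C = pos_ceil (1080 * L ^+ 2 / mu ^+ 2))
    (S : nat) (S_gt0 : (0 < S)%N) :
  (expectation_unif (fun w : S.-tuple (m.-tuple (@draw n1 n2 A B C)) =>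
     objH F G h (SoCK F G h L theta alpha tau1 tau2 x0 w) - objH F G h xstar)
   <= (11 * (12 / 13) ^+ S)%:E * (objH F G h x0 - objH F G h xstar))%E.
Proof.
have [m_gt0 L_le L_ge] := inner_length_bounds mu_gt0 mu_le_L m_def.
have c1 : 0 < 1080 :> R by rewrite ltr0n.
have c2 : 0 < 2160 :> R by rewrite ltr0n.
have A_ge : BG ^+ 4 * LF ^+ 2 / A%:R <= mu ^+ 2 / 2160.
  rewrite A_def -(mulrA 2160); exact: (batch_size_le (BG ^+ 4 * LF ^+ 2) mu_gt0 c2).
have B_ge : (BF * LG) ^+ 2 / B%:R <= mu ^+ 2 / 2160.
  rewrite exprMn B_def -(mulrA 2160); exact: (batch_size_le (BF ^+ 2 * LG ^+ 2) mu_gt0 c2).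
have C_ge : L ^+ 2 / C%:R <= mu ^+ 2 / 1080.
  rewrite C_def; exact: (batch_size_le (L ^+ 2) mu_gt0 c1).
have A_gt0 : (0 < A)%N by rewrite A_def pos_ceil_gt0.
have B_gt0 : (0 < B)%N by rewrite B_def pos_ceil_gt0.
have C_gt0 : (0 < C)%N by rewrite C_def pos_ceil_gt0.
have tau2E : tau2 = tau1 by rewrite tau2_def tau1_def.
(* All points involved lie in [dom h], so the extended-real claim becomes one about real
   averages. *)
have objHE w : dom h w -> objH F G h w = (composite (objf F G) h w)%:E.
  by move=> wD; rewrite /objH (dom_fineE h_pcc wD).
rewrite tau2E (objHE _ (minimizer_dom h_pcc xstar_min)) (objHE _ x0_dom).
have SD := SoCK_dom n1_gt0 n2_gt0 f_convex h_pcc mu_gt0 h_strong F_smooth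
  F_bounded G_smooth G_bounded FG_lip xstar_min A_gt0 B_gt0 C_gt0 A_ge B_ge C_ge
  m_gt0 L_le L_ge tau1_def theta_def alpha_def.
rewrite (_ : (fun w => _) = (fun w => (composite (objf F G) h
    (SoCK F G h L theta alpha tau1 tau1 x0 w) - composite (objf F G) h xstar)%:E)).
  rewrite expectation_unif_EFin -EFinB -EFinM lee_fin.
  exact: (gap_SoCK_le n1_gt0 n2_gt0 f_convex h_pcc mu_gt0 h_strong F_smooth
    F_bounded G_smooth G_bounded FG_lip xstar_min A_gt0 B_gt0 C_gt0 A_ge B_ge C_ge
    m_gt0 L_le L_ge tau1_def theta_def alpha_def).
by apply/funext => w; rewrite (objHE _ (SD _ _ w x0_dom)).
Qed.
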